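(* Let $G$ be a finite group scheme over a field $k$ of characteristic $p>0$, and choose positive integers $m>n$ and integers $m_1,\dots,m_m$ and $n_1,\dots,n_n$ such that all $m_j$ and $n_i$ are even if $p>2$. Choose Tate cohomology classes $\zeta_{i,j}\in\widehat{H}^{m_j-n_i}(G,k)$ and let $\hat\zeta_{i,j}:\Omega^{m_j}(k)\to\Omega^{n_i}(k)$ represent $\zeta_{i,j}$ ($1\le i\le n$, $1\le j\le m$). Consider an exact sequence of $kG$-modules $$0\to L\to M\xrightarrow{\ \varphi=(\hat\zeta_{i,j})\ }N\to 0,$$ where $$M\cong\bigoplus_{j=1}^m\Omega^{m_j}(k)\oplus(\mathrm{proj}),\qquad N\cong\bigoplus_{i=1}^n\Omega^{n_i}(k).$$ Assume that for every $\pi$-point $\alpha_K:K[t]/t^p\to KG$, the restriction of the matrix of cohomology elements $(\alpha_K^*(\zeta_{i,j}))\in M_{n,m}(\widehat{H}^*(K[t]/t^p,K))$ has rank $n$. Then the module $L$ has stable constant Jordan type $(m-n)[1]$.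
   Context: $k$ is a field of characteristic $p>0$. A finite group scheme $G$ over $k$ is a group scheme whose coordinate algebra $k[G]$ is finite dimensional; its group algebra $kG$ is the linear dual of $k[G]$. All $kG$-modules are finitely generated. For a field extension $K/k$, $KG=K\otimes_k kG$ is the group algebra of $G_K=G\times_{\mathrm{Spec}\,k}\mathrm{Spec}\,K$, and $M_K=K\otimes_k M$. A $\pi$-point of $G$ is a left flat map of $K$-algebras $\alpha_K:K[t]/t^p\to KG$, for some field extension $K/k$, which factors through the group algebra $KC_K\subset KG$ of some unipotent abelian subgroup scheme $C_K\subset G_K$; $\alpha_K^*$ denotes restriction along $\alpha_K$ (of modules, and of Tate cohomology classes after base change to $K$). Every finite dimensional $K[t]/t^p$-module is a direct sum of $a_i$ copies of the indecomposables $[i]=K[t]/t^i$, $1\le i\le p$; its Jordan type is $a_p[p]+\cdots+a_1[1]$, and its stable Jordan type is the same expression with the coefficient of $[p]$ disregarded. A finite dimensional $kG$-module has constant Jordan type if the Jordan type of its restriction $\alpha_K^*(M_K)$ is the same for all $\pi$-points; it has stable constant Jordan type $\underline a$ if it has constant Jordan type with stable Jordan type $\underline a$. $\Omega^i(k)$ is the $i$-th Heller shift of the trivial module ($\Omega^1$ = kernel of projective cover, $\Omega^{-1}$ = cokernel of injective hull, iterated). $\widehat{H}^*(G,k)=\widehat{\mathrm{Ext}}^*_{kG}(k,k)$ is Tate cohomology; $\widehat{H}^{a-b}(G,k)\cong\mathrm{Hom}_{\mathrm{stmod}(kG)}(\Omega^a(k),\Omega^b(k))$, where $\mathrm{stmod}(kG)$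 is the stable module category, and a homomorphism $\Omega^a(k)\to\Omega^b(k)$ represents a class if its stable class is that element. ''(proj)'' denotes some (possibly zero) projective $kG$-module, and the notation $\varphi=(\hat\zeta_{i,j})$ means that the component of $\varphi$ from the summand $\Omega^{m_j}(k)$ to the summand $\Omega^{n_i}(k)$ is $\hat\zeta_{i,j}$. Each $\widehat H^s(K[t]/t^p,K)$ is one-dimensional; for $p=2$ the ring $\widehat H^*(K[t]/t^p,K)$, and for $p>2$ its even-degree part, is a Laurent polynomial ring $K[x,x^{-1}]$ on a generator $x$ of degree 1, respectively 2. Thus each entry of the matrix is a scalar times a power of $x$, and the rank of the matrix is the rank of the resulting matrix of scalars. *)

(* Defs.v *)
From HB Require Import structures.
From mathcomp Require Import all_boot all_order all_algebra.

Set Implicit Arguments.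
Unset Strict Implicit.
Unset Printing Implicit Defensive.

Import Order.TTheory GRing.Theory Num.Theory.
Local Open Scope ring_scope.

(* Finite dimensional algebras, modules and Hopf algebras are given by
   structure constants on a basis, so that extension of scalars along a field
   embedding [iota : k -> K] is the entrywise application of [iota].  Vectors
   are columns, modules are left modules, and a linear map is a matrix acting
   on columns from the left. *)

(* e_i e_j = \sum_l (amul i j l) e_l  and  1 = \sum_i (aone i) e_i. *)
Record fdalg (k : fieldType) := FdAlg {
  adim : nat;
  amul : 'I_adim -> 'I_adim -> 'I_adim -> k;
  aone : 'I_adim -> k;
  amulA : forall i j l r,
    \sum_s amul i j s * amul s l r = \sum_s amul j l s * amul i s r;
  amul1l : forall j l, \sum_i aone i * amul i j l = (j == l)%:R;
  amul1r : forall j l, \sum_i aone i * amul j i l = (j == l)%:R }.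

Record fdmod (k : fieldType) (A : fdalg k) := FdMod {
  mdim : nat;
  mact : 'I_(adim A) -> 'M[k]_mdim;
  mactM : forall i j, mact i *m mact j = \sum_l amul i j l *: mact l;
  mact1 : \sum_i aone i *: mact i = 1%:M }.

Notation lin V W := 'M_(mdim W, mdim V).

Definition mod_hom (k : fieldType) (A : fdalg k) (V W : fdmod A)
  (f : lin V W) : Prop := forall i, f *m mact V i = mact W i *m f.

Definition mod_iso (k : fieldType) (A : fdalg k) (V W : fdmod A)
  (f : lin V W) : Prop :=
  mod_hom f /\ exists g : lin W V, f *m g = 1%:M /\ g *m f = 1%:M.

Definition isomorphic (k : fieldType) (A : fdalg k) (V W : fdmod A) : Prop :=
  exists f : lin V W, mod_iso f.

Definition lin_inj (k : fieldType) m n (f : 'M[k]_(m, n)) : Prop :=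
  forall v : 'cV_n, f *m v = 0 -> v = 0.

Definition lin_surj (k : fieldType) m n (f : 'M[k]_(m, n)) : Prop :=
  forall w : 'cV_m, exists v : 'cV_n, w = f *m v.

Definition short_exact (k : fieldType) (A : fdalg k) (U V W : fdmod A)
  (f : lin U V) (g : lin V W) : Prop :=
  [/\ mod_hom f, mod_hom g, lin_inj f, lin_surj g
    & forall v : 'cV_(mdim V), g *m v = 0 <-> exists u, v = f *m u].

Definition projective (k : fieldType) (A : fdalg k) (P : fdmod A) : Prop :=
  forall (V W : fdmod A) (g : lin V W) (f : lin P W),
    mod_hom g -> lin_surj g -> mod_hom f ->
    exists h : lin P V, mod_hom h /\ g *m h = f.

Definition injective_mod (k : fieldType) (A : fdalg k) (I : fdmod A) : Prop :=
  forall (V W : fdmod A) (g : lin V W) (f : lin V I),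
    mod_hom g -> lin_inj g -> mod_hom f ->
    exists h : lin W I, mod_hom h /\ h *m g = f.

Definition projective_cover (k : fieldType) (A : fdalg k) (P V : fdmod A)
  (f : lin P V) : Prop :=
  [/\ projective P, mod_hom f, lin_surj f
    & forall (U : fdmod A) (g : lin U P),
        mod_hom g -> lin_surj (f *m g) -> lin_surj g].

Definition injective_hull (k : fieldType) (A : fdalg k) (V I : fdmod A)
  (f : lin V I) : Prop :=
  [/\ injective_mod I, mod_hom f, lin_inj f
    & forall (U : fdmod A) (g : lin I U),
        mod_hom g -> lin_inj (g *m f) -> lin_inj g].

(* Equality of two homomorphisms in the stable module category. *)
Definition stably_eq (k : fieldType) (A : fdalg k) (V W : fdmod A)
  (f g : lin V W) : Prop :=
  exists (Q : fdmod A) (a : lin V Q) (b : lin Q W),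
    [/\ projective Q, mod_hom a, mod_hom b & f - g = b *m a].

Section DirectSums.
Variables (k : fieldType) (A : fdalg k).

Section Finite.
Variables (n : nat) (V : 'I_n -> fdmod A).

Definition dsum_act (i : 'I_(adim A)) : 'M[k]_(\sum_j mdim (V j)) :=
  \mxdiag_j mact (V j) i.

Let mxdiag_scale (c : k) (B : forall j, 'M[k]_(mdim (V j))) :
  \mxdiag_j (c *: B j) = c *: \mxdiag_j B j.
Proof.
rewrite -mul_scalar_mx -mxdiagZ {3}/mxdiag mul_mxdiag_mxblock /mxdiag.
apply/eq_mxblock => r s; rewrite mul_scalar_mx.
by case: eqVneq => [->|_]; rewrite ?conform_mx_id ?scaler0.
Qed.

Fact dsum_actM i j :
  dsum_act i *m dsum_act j = \sum_l amul i j l *: dsum_act l.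
Proof.
rewrite /dsum_act {2}/mxdiag mul_mxdiag_mxblock.
transitivity (\mxdiag_r (\sum_l amul i j l *: mact (V r) l)).
  rewrite /mxdiag; apply/eq_mxblock => r s.
  by case: eqVneq => [->|_]; rewrite ?conform_mx_id ?mactM ?mulmx0.
by rewrite mxdiag_sum; apply: eq_bigr => l _; rewrite mxdiag_scale.
Qed.

Fact dsum_act1 : \sum_i aone i *: dsum_act i = 1%:M.
Proof.
transitivity (\mxdiag_r (\sum_i aone i *: mact (V r) i)).
  by rewrite mxdiag_sum; apply: eq_bigr => l _; rewrite mxdiag_scale.
by under eq_mxdiag => r do rewrite mact1; rewrite mxdiagZ.
Qed.

Definition dsum : fdmod A := FdMod dsum_actM dsum_act1.
End Finite.

Section Binary.
Variables V W : fdmod A.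

Definition dsum2_act (i : 'I_(adim A)) : 'M[k]_(mdim V + mdim W) :=
  block_mx (mact V i) 0 0 (mact W i).

Let sum_block (c : 'I_(adim A) -> k) :
  \sum_i c i *: dsum2_act i =
  block_mx (\sum_i c i *: mact V i) 0 0 (\sum_i c i *: mact W i).
Proof.
rewrite (eq_bigr (fun i => block_mx (c i *: mact V i) 0 0 (c i *: mact W i)));
  last by move=> i _; rewrite scale_block_mx !scaler0.
apply: (big_rec3 (fun x y z => z = block_mx x 0 0 y)).
  by rewrite -[LHS](@block_mx0 _ (mdim V) (mdim W) (mdim V) (mdim W)).
by move=> i x y z _ ->; rewrite add_block_mx !addr0.
Qed.

Fact dsum2_actM i j :
  dsum2_act i *m dsum2_act j = \sum_l amul i j l *: dsum2_act l.
Proof.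
rewrite sum_block mulmx_block !mulmx0 !mul0mx !addr0 !add0r.
by rewrite !mactM.
Qed.

Fact dsum2_act1 : \sum_i aone i *: dsum2_act i = 1%:M.
Proof. by rewrite sum_block !mact1 -scalar_mx_block. Qed.

Definition dsum2 : fdmod A := FdMod dsum2_actM dsum2_act1.
End Binary.
End DirectSums.

(* [am] is the matrix of a unital algebra map A -> B:
   e_i |-> \sum_b (am b i) e_b. *)
Record alg_hom (k : fieldType) (A B : fdalg k) := AlgHom {
  am : 'M[k]_(adim B, adim A);
  amM : forall i j r,
    \sum_l amul i j l * am r l = \sum_a \sum_b am a i * am b j * amul a b r;
  am1 : forall r, \sum_i aone i * am r i = aone r }.

Section Restriction.
Variables (k : fieldType) (A B : fdalg k) (f : alg_hom A B) (V : fdmod B).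

Definition restrict_act (i : 'I_(adim A)) : 'M[k]_(mdim V) :=
  \sum_b am f b i *: mact V b.

Fact restrict_actM i j :
  restrict_act i *m restrict_act j = \sum_l amul i j l *: restrict_act l.
Proof.
rewrite /restrict_act.
transitivity (\sum_r (\sum_a \sum_b am f a i * am f b j * amul a b r)
                *: mact V r).
  rewrite mulmx_suml.
  under [RHS]eq_bigr => r _ do rewrite scaler_suml.
  rewrite [RHS]exchange_big; apply: eq_bigr => a _ /=.
  rewrite mulmx_sumr.
  under [RHS]eq_bigr => r _ do rewrite scaler_suml.
  rewrite [RHS]exchange_big; apply: eq_bigr => b _ /=.
  rewrite -scalemxAl -scalemxAr mactM scalerA scaler_sumr.
  by apply: eq_bigr => r _; rewrite scalerA.
under eq_bigr => r _ do rewrite -amM scaler_suml.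
rewrite exchange_big; apply: eq_bigr => l _ /=.
by rewrite scaler_sumr; apply: eq_bigr => r _; rewrite scalerA.
Qed.

Fact restrict_act1 : \sum_i aone i *: restrict_act i = 1%:M.
Proof.
rewrite -(mact1 V); under eq_bigr => i _ do rewrite scaler_sumr.
rewrite exchange_big; apply: eq_bigr => r _ /=.
by rewrite -(am1 f) scaler_suml; apply: eq_bigr => i _; rewrite scalerA.
Qed.

Definition restrict : fdmod A := FdMod restrict_actM restrict_act1.
End Restriction.

Section BaseChange.
Variables (k K : fieldType) (iota : {rmorphism k -> K}) (A : fdalg k).

Fact bc_amulA (i j l r : 'I_(adim A)) :
  \sum_s iota (amul i j s) * iota (amul s l r) =
  \sum_s iota (amul j l s) * iota (amul i s r).
Proof.
transitivity (iota (\sum_s amul i j s * amul s l r)).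
  by rewrite rmorph_sum; apply: eq_bigr => s _; rewrite rmorphM.
by rewrite amulA rmorph_sum; apply: eq_bigr => s _; rewrite rmorphM.
Qed.

Fact bc_amul1l (j l : 'I_(adim A)) :
  \sum_i iota (aone i) * iota (amul i j l) = (j == l)%:R.
Proof.
rewrite -(rmorph_nat iota) -amul1l rmorph_sum.
by apply: eq_bigr => s _; rewrite rmorphM.
Qed.

Fact bc_amul1r (j l : 'I_(adim A)) :
  \sum_i iota (aone i) * iota (amul j i l) = (j == l)%:R.
Proof.
rewrite -(rmorph_nat iota) -amul1r rmorph_sum.
by apply: eq_bigr => s _; rewrite rmorphM.
Qed.

Definition bc_alg : fdalg K := FdAlg bc_amulA bc_amul1l bc_amul1r.

Variable V : fdmod A.

Fact bc_actM (i j : 'I_(adim bc_alg)) :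
  map_mx iota (mact V i) *m map_mx iota (mact V j) =
  \sum_l amul i j l *: map_mx iota (mact V l).
Proof.
rewrite -map_mxM mactM raddf_sum /=.
by apply: eq_bigr => l _; rewrite map_mxZ.
Qed.

Fact bc_act1 :
  \sum_(i < adim bc_alg) aone i *: map_mx iota (mact V i) = 1%:M.
Proof.
rewrite -(map_mx1 iota) -(mact1 V) raddf_sum /=.
by apply: eq_bigr => l _; rewrite map_mxZ.
Qed.

Definition bc_mod : fdmod bc_alg := FdMod bc_actM bc_act1.
End BaseChange.

Section Regular.
Variables (k : fieldType) (A : fdalg k).

Definition reg_act (i : 'I_(adim A)) : 'M[k]_(adim A) :=
  \matrix_(l, j) amul i j l.

Fact reg_actM i j : reg_act i *m reg_act j = \sum_l amul i j l *: reg_act l.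
Proof.
apply/matrixP => r l; rewrite !mxE summxE.
under [RHS]eq_bigr => s _ do rewrite !mxE.
by rewrite amulA; apply: eq_bigr => s _; rewrite !mxE mulrC.
Qed.

Fact reg_act1 : \sum_i aone i *: reg_act i = 1%:M.
Proof.
apply/matrixP => l j; rewrite summxE !mxE eq_sym -amul1l.
by apply: eq_bigr => i _; rewrite !mxE.
Qed.

Definition regular : fdmod A := FdMod reg_actM reg_act1.

Fact op_amulA (i j l r : 'I_(adim A)) :
  \sum_s amul j i s * amul l s r = \sum_s amul l j s * amul s i r.
Proof. by rewrite amulA. Qed.

(* Right A-modules are left modules over the opposite algebra. *)
Definition op_alg : fdalg k :=
  FdAlg op_amulA (@amul1r _ A) (@amul1l _ A).
End Regular.

(* X (x)_k Y is the space of matrices 'M_(dim X, dim Y), x (x) y being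
   x *m y^T; the tensors that vanish in X (x)_A Y are the sums of the
   x e_i (x) y - x (x) e_i y. *)
Definition tensor_zero (k : fieldType) (A : fdalg k)
  (X : fdmod (op_alg A)) (Y : fdmod A) (T : 'M[k]_(mdim X, mdim Y)) : Prop :=
  exists S : 'I_(adim A) -> 'M[k]_(mdim X, mdim Y),
    T = \sum_i (mact X i *m S i - S i *m (mact Y i)^T).

Definition flat (k : fieldType) (A : fdalg k) (Y : fdmod A) : Prop :=
  forall (X X' : fdmod (op_alg A)) (f : lin X X'),
    mod_hom f -> lin_inj f ->
    forall T : 'M[k]_(mdim X, mdim Y),
      tensor_zero (X := X') (Y := Y) (f *m T) -> tensor_zero T.

(* A finite group scheme G = Spec k[G], given by the commutative Hopf algebra
   k[G] on a basis e_i: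
     e_i e_j = \sum_l (hmul i j l) e_l,      1 = \sum_i (hone i) e_i,
     Delta e_l = \sum_(i, j) (hcomul l i j) e_i (x) e_j,
     counit e_i = hcounit i,     antipode e_i = \sum_j (hanti i j) e_j. *)
Record fin_group_scheme (k : fieldType) := FinGroupScheme {
  hdim : nat;
  hmul : 'I_hdim -> 'I_hdim -> 'I_hdim -> k;
  hone : 'I_hdim -> k;
  hcomul : 'I_hdim -> 'I_hdim -> 'I_hdim -> k;
  hcounit : 'I_hdim -> k;
  hanti : 'I_hdim -> 'I_hdim -> k;
  hmulC : forall i j l, hmul i j l = hmul j i l;
  hmulA : forall i j l r,
    \sum_s hmul i j s * hmul s l r = \sum_s hmul j l s * hmul i s r;
  hmul1 : forall j l, \sum_i hone i * hmul i j l = (j == l)%:R;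
  hcomulA : forall r i j l,
    \sum_s hcomul s i j * hcomul r s l = \sum_s hcomul s j l * hcomul r i s;
  hcounitl : forall r j, \sum_i hcounit i * hcomul r i j = (r == j)%:R;
  hcounitr : forall r j, \sum_i hcounit i * hcomul r j i = (r == j)%:R;
  hcomulM : forall i j a b,
    \sum_l hmul i j l * hcomul l a b =
    \sum_a1 \sum_b1 \sum_a2 \sum_b2
      hcomul i a1 b1 * hcomul j a2 b2 * (hmul a1 a2 a * hmul b1 b2 b);
  hcomul1 : forall i j, \sum_l hone l * hcomul l i j = hone i * hone j;
  hcounitM : forall i j, \sum_l hmul i j l * hcounit l = hcounit i * hcounit j;
  hcounit1 : \sum_i hone i * hcounit i = 1;
  hantil : forall i r,
    \sum_a \sum_b \sum_c hcomul i a b * hanti a c * hmul c b r =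
    hcounit i * hone r;
  hantir : forall i r,
    \sum_a \sum_b \sum_c hcomul i a b * hanti b c * hmul a c r =
    hcounit i * hone r }.

Section GroupAlgebra.
Variables (k : fieldType) (G : fin_group_scheme k).

(* On the basis of kG dual to (e_i), the product is the transpose of the
   coproduct of k[G] and the unit is the counit of k[G]. *)
Let gmul (i j l : 'I_(hdim G)) : k := hcomul l i j.

Fact group_alg_mulA i j l r :
  \sum_s gmul i j s * gmul s l r = \sum_s gmul j l s * gmul i s r.
Proof. exact: hcomulA. Qed.

Fact group_alg_mul1l j l : \sum_i hcounit i * gmul i j l = (j == l)%:R.
Proof. by rewrite hcounitl eq_sym. Qed.

Fact group_alg_mul1r j l : \sum_i hcounit i * gmul j i l = (j == l)%:R.
Proof. by rewrite hcounitr eq_sym. Qed.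

Definition group_alg : fdalg k :=
  FdAlg group_alg_mulA group_alg_mul1l group_alg_mul1r.

(* kG acts on k through x |-> x(1), the evaluation at 1 \in k[G]. *)
Fact triv_actM (i j : 'I_(adim group_alg)) :
  (hone i)%:M *m (hone j)%:M
    = \sum_l amul i j l *: ((hone l)%:M : 'M[k]_1).
Proof.
rewrite -scalar_mxM -hcomul1 raddf_sum /=; apply: eq_bigr => l _.
by rewrite scale_scalar_mx mulrC.
Qed.

Fact triv_act1 :
  \sum_(i < adim group_alg) aone i *: ((hone i)%:M : 'M[k]_1) = 1%:M.
Proof.
rewrite -(hcounit1 G) raddf_sum /=; apply: eq_bigr => l _.
by rewrite scale_scalar_mx mulrC.
Qed.

Definition trivial_mod : fdmod group_alg := FdMod triv_actM triv_act1.

Definition abelian_scheme : Prop :=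
  forall l i j : 'I_(hdim G), hcomul l i j = hcomul l j i.

(* Every nonzero representation has a nonzero fixed vector. *)
Definition unipotent_scheme : Prop :=
  forall V : fdmod group_alg, (0 < mdim V)%N ->
    exists v : 'cV_(mdim V),
      v != 0 /\ forall i : 'I_(hdim G), mact V i *m v = hone i *: v.
End GroupAlgebra.

Section BaseChangeScheme.
Variables (k K : fieldType) (iota : {rmorphism k -> K}).
Variable G : fin_group_scheme k.
Implicit Types i j l r a b : 'I_(hdim G).

Let mul i j l := iota (hmul i j l).
Let one i := iota (hone i).
Let comul l i j := iota (hcomul l i j).
Let counit i := iota (hcounit i).
Let anti i j := iota (hanti i j).

Fact bc_hmulC i j l : mul i j l = mul j i l.
Proof. by rewrite /mul hmulC. Qed.

Fact bc_hmulA i j l r :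
  \sum_s mul i j s * mul s l r = \sum_s mul j l s * mul i s r.
Proof.
transitivity (iota (\sum_s hmul i j s * hmul s l r)).
  by rewrite rmorph_sum; apply: eq_bigr => s _; rewrite rmorphM.
by rewrite hmulA rmorph_sum; apply: eq_bigr => s _; rewrite rmorphM.
Qed.

Fact bc_hmul1 j l : \sum_i one i * mul i j l = (j == l)%:R.
Proof.
rewrite -(rmorph_nat iota) -hmul1 rmorph_sum.
by apply: eq_bigr => s _; rewrite rmorphM.
Qed.

Fact bc_hcomulA r i j l :
  \sum_s comul s i j * comul r s l = \sum_s comul s j l * comul r i s.
Proof.
transitivity (iota (\sum_s hcomul s i j * hcomul r s l)).
  by rewrite rmorph_sum; apply: eq_bigr => s _; rewrite rmorphM.
by rewrite hcomulA rmorph_sum; apply: eq_bigr => s _; rewrite rmorphM.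
Qed.

Fact bc_hcounitl r j : \sum_i counit i * comul r i j = (r == j)%:R.
Proof.
rewrite -(rmorph_nat iota) -hcounitl rmorph_sum.
by apply: eq_bigr => s _; rewrite rmorphM.
Qed.

Fact bc_hcounitr r j : \sum_i counit i * comul r j i = (r == j)%:R.
Proof.
rewrite -(rmorph_nat iota) -hcounitr rmorph_sum.
by apply: eq_bigr => s _; rewrite rmorphM.
Qed.

Fact bc_hcomulM i j a b :
  \sum_l mul i j l * comul l a b =
  \sum_a1 \sum_b1 \sum_a2 \sum_b2
    comul i a1 b1 * comul j a2 b2 * (mul a1 a2 a * mul b1 b2 b).
Proof.
transitivity (iota (\sum_l hmul i j l * hcomul l a b)).
  by rewrite rmorph_sum; apply: eq_bigr => s _; rewrite rmorphM.
rewrite hcomulM rmorph_sum; apply: eq_bigr => a1 _.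
rewrite rmorph_sum; apply: eq_bigr => b1 _.
rewrite rmorph_sum; apply: eq_bigr => a2 _.
by rewrite rmorph_sum; apply: eq_bigr => b2 _; rewrite !rmorphM.
Qed.

Fact bc_hcomul1 i j : \sum_l one l * comul l i j = one i * one j.
Proof.
rewrite -rmorphM -hcomul1 rmorph_sum.
by apply: eq_bigr => s _; rewrite rmorphM.
Qed.

Fact bc_hcounitM i j : \sum_l mul i j l * counit l = counit i * counit j.
Proof.
rewrite -rmorphM -hcounitM rmorph_sum.
by apply: eq_bigr => s _; rewrite rmorphM.
Qed.

Fact bc_hcounit1 : \sum_i one i * counit i = 1.
Proof.
rewrite -(rmorph1 iota) -(hcounit1 G) rmorph_sum.
by apply: eq_bigr => s _; rewrite rmorphM.
Qed.

Fact bc_hantil i r :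
  \sum_a \sum_b \sum_c comul i a b * anti a c * mul c b r = counit i * one r.
Proof.
rewrite -rmorphM -hantil rmorph_sum; apply: eq_bigr => a _.
rewrite rmorph_sum; apply: eq_bigr => b _.
by rewrite rmorph_sum; apply: eq_bigr => c _; rewrite !rmorphM.
Qed.

Fact bc_hantir i r :
  \sum_a \sum_b \sum_c comul i a b * anti b c * mul a c r = counit i * one r.
Proof.
rewrite -rmorphM -hantir rmorph_sum; apply: eq_bigr => a _.
rewrite rmorph_sum; apply: eq_bigr => b _.
by rewrite rmorph_sum; apply: eq_bigr => c _; rewrite !rmorphM.
Qed.

Definition bc_scheme : fin_group_scheme K :=
  FinGroupScheme bc_hmulC bc_hmulA bc_hmul1 bc_hcomulA bc_hcounitl bc_hcounitr
    bc_hcomulM bc_hcomul1 bc_hcounitM bc_hcounit1 bc_hantil bc_hantir.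
End BaseChangeScheme.

(* A closed subgroup scheme C of G: a surjective map of Hopf algebras
   k[G] -> k[C], e_i |-> \sum_j (res j i) c_j (such a map preserves the
   antipodes).  Its transpose is the inclusion kC -> kG. *)
Definition subgroup_scheme (k : fieldType) (G C : fin_group_scheme k)
  (res : 'M[k]_(hdim C, hdim G)) : Prop :=
  [/\ forall i j r, \sum_l hmul i j l * res r l =
        \sum_a \sum_b res a i * res b j * hmul a b r,
      forall r, \sum_i hone i * res r i = hone r,
      forall i a b, \sum_r res r i * hcomul r a b =
        \sum_s \sum_t hcomul i s t * res a s * res b t,
      forall i, \sum_r res r i * hcounit r = hcounit i
    & lin_surj res].

Section Truncated.
Variables (K : fieldType) (p : nat).

(* K[t]/t^p on the basis 1, t, ..., t^(p-1). *)
Let tmul (i j l : 'I_p) : K := (i + j == l)%N%:R.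
Let tone (i : 'I_p) : K := (i == 0 :> nat)%:R.

Let sum_tmul (i j : 'I_p) (F : nat -> K) :
  (forall s, (p <= s)%N -> F s = 0) -> \sum_s tmul i j s * F s = F (i + j)%N.
Proof.
move=> F0; have [lt_ij|le_ij] := ltnP (i + j) p; last first.
  rewrite F0 // big1 // => s _; rewrite /tmul.
  by case: eqP => [e|]; rewrite ?mul0r // -e F0 ?mulr0.
rewrite (bigD1 (Ordinal lt_ij)) //= /tmul eqxx mul1r big1 ?addr0 // => s.
by rewrite -val_eqE /= eq_sym => /negPf ->; rewrite mul0r.
Qed.

Fact trunc_mulA i j l r :
  \sum_s tmul i j s * tmul s l r = \sum_s tmul j l s * tmul i s r.
Proof.
rewrite (@sum_tmul i j (fun s => (s + l == r)%N%:R)); last first.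
  move=> s le_ps; rewrite gtn_eqF // ltn_addr //.
  exact: leq_trans (ltn_ord r) le_ps.
rewrite (@sum_tmul j l (fun s => (i + s == r)%N%:R)) ?addnA //.
move=> s le_ps; rewrite gtn_eqF // ltn_addl //.
exact: leq_trans (ltn_ord r) le_ps.
Qed.

Let sum_tone (j : 'I_p) (F : nat -> K) : \sum_i tone i * F i = F 0.
Proof.
have p_gt0 : (0 < p)%N by apply: leq_ltn_trans (ltn_ord j).
rewrite (bigD1 (Ordinal p_gt0)) //= /tone eqxx mul1r big1 ?addr0 // => s.
by rewrite -val_eqE /= => /negPf ->; rewrite mul0r.
Qed.

Fact trunc_mul1l j l : \sum_i tone i * tmul i j l = (j == l)%:R.
Proof. exact: (sum_tone j (fun i => (i + j == l)%N%:R)). Qed.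

Fact trunc_mul1r j l : \sum_i tone i * tmul j i l = (j == l)%:R.
Proof. by rewrite (sum_tone j (fun i => (j + i == l)%N%:R)) addn0. Qed.

Definition trunc_alg : fdalg K := FdAlg trunc_mulA trunc_mul1l trunc_mul1r.

Section Block.
Variable i : 'I_p.

(* The indecomposable [i.+1] = K[t]/t^i.+1, of dimension i.+1. *)
Let jact (j : 'I_p) : 'M[K]_i.+1 := \matrix_(r, c) (j + c == r :> nat)%N%:R.

Fact jordan_block_actM (a b : 'I_(adim trunc_alg)) :
  jact a *m jact b = \sum_l amul a b l *: jact l.
Proof.
apply/matrixP => r c; rewrite !mxE summxE.
under [RHS]eq_bigr => l _ do rewrite !mxE.
transitivity ((a + b + c == r)%N%:R : K); last first.
  symmetry; apply: (@sum_tmul a b (fun l => (l + c == r)%N%:R)) => s le_ps.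
  rewrite gtn_eqF // ltn_addr //; apply: leq_trans le_ps.
  exact: leq_trans (ltn_ord r) (ltn_ord i).
under eq_bigr => s _ do rewrite !mxE.
have [lt_bc|le_bc] := ltnP (b + c) i.+1.
  rewrite (bigD1 (Ordinal lt_bc)) //= eqxx mulr1 addnA big1 ?addr0 // => s.
  by rewrite -val_eqE /= eq_sym => /negPf ->; rewrite mulr0.
rewrite big1 => [|s _]; last first.
  by rewrite (gtn_eqF (leq_trans (ltn_ord s) le_bc)) mulr0.
rewrite gtn_eqF // -addnA; apply: leq_trans (ltn_ord r) _.
by apply: leq_trans le_bc _; apply: leq_addl.
Qed.

Fact jordan_block_act1 :
  \sum_(j < adim trunc_alg) aone j *: jact j = 1%:M.
Proof.
apply/matrixP => r c; rewrite summxE !mxE.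
under eq_bigr => l _ do rewrite !mxE.
by rewrite (sum_tone i (fun l => (l + c == r)%N%:R)) add0n eq_sym.
Qed.

Definition jordan_block : fdmod trunc_alg :=
  FdMod jordan_block_actM jordan_block_act1.
End Block.

(* V is the direct sum of (a i) copies of [i.+1], i < p. *)
Definition jordan_type (V : fdmod trunc_alg) (a : 'I_p -> nat) : Prop :=
  isomorphic V (dsum (fun i => dsum (fun _ : 'I_(a i) => jordan_block i))).
End Truncated.

Record pi_point (k : fieldType) (G : fin_group_scheme k) (p : nat) := PiPoint {
  pfield : fieldType;
  pext : {rmorphism k -> pfield};
  pmap : alg_hom (trunc_alg pfield p) (bc_alg pext (group_alg G));
  pflat : flat (restrict pmap (regular (bc_alg pext (group_alg G))));
  pfactor : exists (C : fin_group_scheme pfield)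
      (res : 'M[pfield]_(hdim C, hdim (bc_scheme pext G)))
      (beta : alg_hom (trunc_alg pfield p) (group_alg C)),
    [/\ subgroup_scheme res, abelian_scheme C, unipotent_scheme C
      & am pmap = res^T *m am beta] }.

Definition pi_restrict (k : fieldType) (G : fin_group_scheme k) (p : nat)
  (pi : pi_point G p) (V : fdmod (group_alg G)) :
  fdmod (trunc_alg (pfield pi) p) :=
  restrict (pmap pi) (bc_mod (pext pi) V).

Definition constant_jordan_type (k : fieldType) (G : fin_group_scheme k)
  (p : nat) (V : fdmod (group_alg G)) (a : 'I_p -> nat) : Prop :=
  forall pi : pi_point G p, jordan_type (pi_restrict pi V) a.

(* [s i] is the coefficient of [i.+1]; that of [p] is disregarded. *)
Definition stable_constant_jordan_type (k : fieldType)
  (G : fin_group_scheme k) (p : nat) (V : fdmod (group_alg G))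
  (s : nat -> nat) : Prop :=
  exists a : 'I_p -> nat,
    constant_jordan_type V a /\ forall i : 'I_p, (i.+1 < p)%N -> a i = s i.

(* Homomorphisms syz (a+1) -> term a -> syz a for all integers a; their
   splices d_a : term (a+1) -> syz (a+1) -> term a form a complex when the
   sequences are short exact. *)
Record tower (k : fieldType) (A : fdalg k) := Tower {
  syz : int -> fdmod A;
  term : int -> fdmod A;
  tinc : forall a : int, 'M[k]_(mdim (term a), mdim (syz (a + 1)));
  tprj : forall a : int, 'M[k]_(mdim (syz a), mdim (term a)) }.

(* A complete (Tate) resolution of V, with a-th syzygy syz a. *)
Definition complete_resolution (k : fieldType) (A : fdalg k) (V : fdmod A)
  (T : tower A) : Prop :=
  [/\ forall a, short_exact (tinc T a) (tprj T a),
      forall a, projective (term T a)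
    & isomorphic (syz T 0) V].

(* In this case syz a is the Heller shift Omega^a(V) for every a: iterated
   kernels of projective covers for a > 0, iterated cokernels of injective
   hulls for a < 0. *)
Definition heller_resolution (k : fieldType) (A : fdalg k) (V : fdmod A)
  (T : tower A) : Prop :=
  [/\ complete_resolution V T,
      forall a : int, 0 <= a -> projective_cover (tprj T a)
    & forall a : int, a < 0 -> injective_hull (tinc T a)].

Section TateCohomology.
Variables (k : fieldType) (A : fdalg k) (T : tower A).

Definition tdiff (a : int) :
  'M[k]_(mdim (term T a), mdim (term T (a + 1))) :=
  tinc T a *m tprj T (a + 1).

(* For a complete resolution T of V, Tate Ext^s_A(V, V) is the space of
   homotopy classes of chain maps of degree s, i.e. of families of maps
   h a b : term a -> term b, with a = b + s, that commute with the
   differentials; its product is the composition of chain maps.  In a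
   graded_map of degree s only the components with a = b + s matter. *)
Definition graded_map :=
  forall a b : int, 'M[k]_(mdim (term T b), mdim (term T a)).

Definition chain_map (s : int) (h : graded_map) : Prop :=
  forall a b : int, a = b + s ->
    mod_hom (h a b) /\ tdiff b *m h (a + 1) (b + 1) = h a b *m tdiff a.

Definition homotopic (s : int) (h h' : graded_map) : Prop :=
  exists sigma : graded_map,
    (forall a b : int, a = b + s -> mod_hom (sigma a (b + 1))) /\
    forall a b : int, a = b + s ->
      h (a + 1) (b + 1) - h' (a + 1) (b + 1) =
      tdiff (b + 1) *m sigma (a + 1) (b + 1 + 1) + sigma a (b + 1) *m tdiff a.

(* h after h', where h' has degree s'. *)
Definition fcomp (s' : int) (h h' : graded_map) : graded_map :=
  fun a c => h (a - s') c *m h' a (a - s').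

Definition fscale (c : k) (h : graded_map) : graded_map :=
  fun a b => c *: h a b.

(* The identity matrix when a = b. *)
Definition fone : graded_map := fun a b => \matrix_(i, j) (i == j :> nat)%:R.

Definition fpow (e : int) (x : graded_map) (n : nat) : graded_map :=
  iter n (fun h => fcomp e h x) fone.

(* x^r for x of degree e with inverse y. *)
Definition fzpow (e : int) (x y : graded_map) (r : int) : graded_map :=
  match r with
  | Posz n => fpow e x n
  | Negz n => fpow (- e) y n.+1
  end.

(* The part of Tate Ext^*_A(V, V) in degrees divisible by e is k[x, x^-1],
   with x of degree e and x^-1 = y. *)
Definition laurent_generator (e : int) (x y : graded_map) : Prop :=
  [/\ chain_map e x /\ chain_map (- e) y,
      homotopic 0 (fcomp (- e) x y) fone,
      homotopic 0 (fcomp e y x) fone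
    & forall (r : int) (z : graded_map), chain_map (r * e) z ->
        exists c : k, homotopic (r * e) z (fscale c (fzpow e x y r))].

(* The matrix (z i j), with z i j in degree deg i j (a multiple of e), is
   (c i j) x^(deg i j / e) for a matrix of scalars c of rank r. *)
Definition tate_rank (e : int) (n m : nat) (deg : 'I_n -> 'I_m -> int)
  (z : 'I_n -> 'I_m -> graded_map) (r : nat) : Prop :=
  exists (x y : graded_map) (c : 'M[k]_(n, m)),
    [/\ laurent_generator e x y,
        forall i j, homotopic (deg i j) (z i j)
          (fscale (c i j) (fzpow e x y (deg i j %/ e)%Z))
      & \rank c = r].

(* f : Omega^a -> Omega^b represents the class of h, of degree a - b: it is
   stably equal to the map induced by h on syzygies. *)
Definition represents (h : graded_map) (a b : int)
  (f : lin (syz T a) (syz T b)) : Prop :=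
  exists g : lin (syz T a) (syz T b),
    [/\ mod_hom g, g *m tprj T a = tprj T b *m h a b & stably_eq f g].
End TateCohomology.

(* Since pmap is flat, this takes complete resolutions of k over kG to
   complete resolutions of K over K[t]/t^p, so that [pi_family] induces the
   restriction map on Tate cohomology. *)
Definition pi_tower (k : fieldType) (G : fin_group_scheme k) (p : nat)
  (pi : pi_point G p) (T : tower (group_alg G)) :
  tower (trunc_alg (pfield pi) p) :=
  @Tower _ _ (fun a => pi_restrict pi (syz T a))
    (fun a => pi_restrict pi (term T a))
    (fun a => map_mx (pext pi) (tinc T a))
    (fun a => map_mx (pext pi) (tprj T a)).

Definition pi_family (k : fieldType) (G : fin_group_scheme k) (p : nat)
  (pi : pi_point G p) (T : tower (group_alg G)) (h : graded_map T) :
  graded_map (pi_tower pi T) :=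
  fun a b => map_mx (pext pi) (h a b).

Definition gen_degree (p : nat) : int := if p == 2%N then 1 else 2.

(* Main.v *)
Require Import Defs.
From HB Require Import structures.
From mathcomp Require Import all_boot all_order all_algebra.
From mathcomp Require Import zify.

Set Implicit Arguments.
Unset Strict Implicit.
Unset Printing Implicit Defensive.

Import Order.TTheory GRing.Theory Num.Theory.
Local Open Scope ring_scope.

(** Restriction along a pi-point turns every module into a vector space with an
    operator t, t^p = 0, where [i] is a Jordan block of size i.  Put
    rho V = rank (t^(p-1)), the number of blocks of full size.  The proof reads
    Jordan types off the two ranks of t and t^(p-1): V is s[1] + rho[p] if and
    only if rank t = (p - 1) rho and dim V = s + p rho; this is the predicate
    [stably_trivial s V], and [jordan_type_of_stably_trivial] produces the
    decomposition.  For s = 0 it says that V is free.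

    Modules met along the way.  A projective kG-module becomes a summand of a
    flat K[t]/t^p-module, and a flat module is free
    ([pi_restrict_projective]).  In a short exact sequence with free middle
    term the ranks of the two ends determine each other
    ([heller_ranks]), so that along a complete resolution of the trivial module
    the stable types [1] and [p - 1] alternate; hence Omega^a(k) is stably [1]
    whenever a is even, or p = 2 ([heller_parity_tower]).  Consequently M and N
    restrict to stable types m[1] and n[1].

    The kernel L.  Suppose that every t-fixed vector of N lifts, modulo
    t^(p-1) N, to a t-fixed vector of M.  Then the preimages of ker t and of
    ker t^(p-1) in N are already covered by the corresponding kernels in M, so
    rank t and rank t^(p-1) are additive in 0 -> L -> M -> N -> 0, and L is
    stably (m - n)[1] ([kernel_stably_trivial]).  The coefficient of [p] is then
    forced by dim L, hence is the same at all pi-points.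

    The lifting.  This is surjectivity of M -> N on the functor
    ker t / im t^(p-1), which is Tate cohomology in degree 0.  On Omega^a it is
    a line.  Chain maps act on these lines, homotopic ones equally, and the
    invertible generator x lets one choose bases W_a with x W_a = W_(a - e)
    ([fzpow_coherent]).  In these bases the map from Omega^(m_j) to Omega^(n_i)
    is the scalar c_ij, where (c_ij) is the matrix of rank n of the hypothesis;
    a right inverse of it provides the lifts ([zhat_matrix_onto_socle]). *)

(** * Column spaces, ranks and exactness *)

Section ColumnSpaces.
Variable K : fieldType.

(** Linear maps act on columns here while the subspace calculus is about row
    spaces; this is the bridge between the two. *)
Lemma colspanP m n q (A : 'M[K]_(m, n)) (B : 'M[K]_(m, q)) :
  reflect (exists D, B = A *m D) (B^T <= A^T)%MS.
Proof.
apply: (iffP submxP) => [[D e] | [D ->]].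
  by exists D^T; rewrite -[LHS]trmxK e trmx_mul trmxK.
by exists D^T; rewrite trmx_mul.
Qed.

Lemma colspan_of_cols m n q (A : 'M[K]_(m, n)) (B : 'M[K]_(m, q)) :
  (forall c : 'cV_q, exists d, B *m c = A *m d) -> exists D, B = A *m D.
Proof.
move=> h; apply/colspanP/row_subP => j; rewrite -tr_col colE.
by apply/colspanP; apply: h.
Qed.

Lemma colspan_rank m n q (A : 'M[K]_(m, n)) (B : 'M[K]_(m, q)) :
  (exists D, B = A *m D) -> (\rank B <= \rank A)%N.
Proof. by case=> D ->; apply: mxrankM_maxl. Qed.

Lemma ker_sub_im_rank m n q (A : 'M[K]_(m, n)) (B : 'M[K]_(n, q)) :
  (forall v : 'cV_n, A *m v = 0 -> exists w, v = B *m w) ->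
  (n <= \rank A + \rank B)%N.
Proof.
move=> h; have := mxrank_coker A.
suff : (\rank (cokermx A) <= \rank B)%N by have := rank_leq_col A; lia.
apply/colspan_rank/colspan_of_cols => c; apply: h.
by rewrite mulmxA mulmx_coker mul0mx.
Qed.

Lemma ker_sub_im m n q (A : 'M[K]_(m, n)) (B : 'M[K]_(n, q)) :
  A *m B = 0 -> (n <= \rank A + \rank B)%N ->
  forall r (v : 'M_(n, r)), A *m v = 0 -> exists w, v = B *m w.
Proof.
move=> AB0 le_n r v Av0; apply/colspanP.
have sB : (B^T <= kermx A^T)%MS by apply/sub_kermxP; rewrite -trmx_mul AB0 trmx0.
have sv : (v^T <= kermx A^T)%MS by apply/sub_kermxP; rewrite -trmx_mul Av0 trmx0.
apply: submx_trans sv _; rewrite -(geq_leqif (mxrank_leqif_sup sB)).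
by rewrite mxrank_ker !mxrank_tr; lia.
Qed.

Lemma rank_row_mx_exact m n q s (A : 'M[K]_(m, n)) (B : 'M[K]_(n, q))
    (X : 'M[K]_(n, s)) :
  A *m B = 0 -> (\rank A + \rank B)%N = n ->
  (\rank (A *m X) + \rank B)%N = \rank (row_mx B X).
Proof.
move=> AB0 rAB; have sB : (B^T <= kermx A^T)%MS.
  by apply/sub_kermxP; rewrite -trmx_mul AB0 trmx0.
have eB : (kermx A^T :=: B^T)%MS.
  apply/eqmx_sym/eqmxP; rewrite -(mxrank_leqif_eq sB).
  by rewrite mxrank_ker !mxrank_tr; apply/eqP; lia.
rewrite -(mxrank_tr (row_mx B X)) tr_row_mx.
rewrite -(mxrank_mul_ker (col_mx B^T X^T) A^T); congr (_ + _)%N.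
  rewrite mul_col_mx -!trmx_mul AB0 trmx0 -addsmxE.
  by rewrite adds0mx mxrank_tr.
rewrite (cap_eqmx (eqmx_refl _) eB) -(mxrank_tr B).
by apply/esym/eqmx_rank/eqmxP/capmx_idPr; rewrite -addsmxE addsmxSl.
Qed.

Lemma rank_row_mxC m n q (A : 'M[K]_(m, n)) (B : 'M[K]_(m, q)) :
  \rank (row_mx A B) = \rank (row_mx B A).
Proof.
rewrite -mxrank_tr -(mxrank_tr (row_mx B A)) !tr_row_mx -!addsmxE.
by rewrite addsmxC.
Qed.

(** Both sides are the rank of B and f put side by side: A kills exactly the
    columns of B, and g exactly those of f.  Applied to A = t^i and B = t^(p-i)
    on a free module, it compares the ranks of t on the two ends of a short
    exact sequence. *)
Lemma rank_exact_pair m n q r s (A : 'M[K]_(m, n)) (B : 'M[K]_(n, q))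
    (g : 'M[K]_(r, n)) (f : 'M[K]_(n, s)) :
  A *m B = 0 -> (\rank A + \rank B)%N = n ->
  g *m f = 0 -> (\rank g + \rank f)%N = n ->
  (\rank (A *m f) + \rank B = \rank (g *m B) + \rank f)%N.
Proof.
by move=> AB0 rAB gf0 rgf; rewrite !rank_row_mx_exact // rank_row_mxC.
Qed.

Lemma lin_injP m n (f : 'M[K]_(m, n)) : lin_inj f <-> \rank f = n.
Proof.
split=> [inj_f | rf v fv0].
  apply/eqP; rewrite eqn_leq rank_leq_col /=.
  have := @ker_sub_im_rank _ _ 0 f 0; rewrite mxrank0 addn0; apply => v /inj_f ->.
  by exists 0; rewrite mul0mx.
have [] := @ker_sub_im _ _ 0 f 0 _ _ _ v fv0; rewrite ?mulmx0 ?rf ?leq_addr //.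
by move=> w ->; rewrite mul0mx.
Qed.

Lemma lin_surjP m n (f : 'M[K]_(m, n)) : lin_surj f <-> \rank f = m.
Proof.
split=> [sur_f | rf w].
  apply/eqP; rewrite eqn_leq rank_leq_row /= -{1}(mxrank1 K m).
  apply/colspan_rank/colspan_of_cols => c; have [d e] := sur_f c.
  by exists d; rewrite mul1mx.
have ff : row_full f^T by rewrite /row_full mxrank_tr rf.
by apply/colspanP; apply: submx_full.
Qed.

Lemma rank_mulmx_free m n q (f : 'M[K]_(m, n)) (A : 'M[K]_(n, q)) :
  \rank f = n -> \rank (f *m A) = \rank A.
Proof.
move=> rf; rewrite -mxrank_tr trmx_mul mxrankMfree ?mxrank_tr //.
by rewrite /row_free mxrank_tr rf.
Qed.

Lemma rank_mulmx_full m n q (f : 'M[K]_(m, n)) (A : 'M[K]_(q, m)) :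
  \rank f = m -> \rank (A *m f) = \rank A.
Proof.
move=> rf; rewrite -mxrank_tr trmx_mul.
by rewrite (eqmxMfull _ _) ?mxrank_tr // /row_full mxrank_tr rf.
Qed.

End ColumnSpaces.

(** Exactness as a count of ranks, the form that survives extension of
    scalars. *)
Lemma short_exact_ranks (K : fieldType) (A : fdalg K) (U V W : fdmod A)
    (f : lin U V) (g : lin V W) :
  short_exact f g <->
  [/\ mod_hom f, mod_hom g, \rank f = mdim U, \rank g = mdim W
    & g *m f = 0 /\ (\rank g + \rank f)%N = mdim V].
Proof.
split=> [[hf hg /lin_injP rf /lin_surjP rg ex] | [hf hg rf rg [gf0 rgf]]].
  have gf0 : g *m f = 0.
    have [|D ->] := @colspan_of_cols K _ 0 _ 0 (g *m f); last by rewrite mul0mx.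
    by move=> c; exists 0; rewrite mul0mx -mulmxA; apply/ex; exists c.
  split=> //; split=> //; apply/eqP; rewrite eqn_leq; apply/andP; split.
    have := mulmx0_rank_max gf0; lia.
  by apply: ker_sub_im_rank => v /ex.
split=> //; [exact/lin_injP | exact/lin_surjP |].
move=> v; split=> [gv0|[u ->]]; last by rewrite mulmxA gf0 mul0mx.
by apply: (ker_sub_im gf0); rewrite ?rgf.
Qed.

(** * The operator t on K[t]/t^p-modules *)

Section TAction.
Variables (K : fieldType) (p : nat).
Implicit Types U V W : fdmod (trunc_alg K p).

(** The action of t^i, extended by 0 to exponents i >= p so that exponents add
    without side conditions. *)
Definition tact V (i : nat) : 'M[K]_(mdim V) :=
  if insub i is Some j then mact V (j : 'I_p) else 0.

Lemma tactE V (i : 'I_p) : tact V i = mact V i.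
Proof. by rewrite /tact valK. Qed.

Lemma tact_ge V i : (p <= i)%N -> tact V i = 0.
Proof. by rewrite /tact; case: insubP => // j; rewrite ltnNge => /negPf ->. Qed.

Lemma tact0 V : (0 < p)%N -> tact V 0 = 1%:M.
Proof.
move=> p_gt0; rewrite -(mact1 V) (bigD1 (Ordinal p_gt0)) //= big1 => [|i].
  by rewrite scale1r addr0 -tactE.
by rewrite -val_eqE /= => /negPf ->; rewrite scale0r.
Qed.

Lemma tactD V i j : tact V i *m tact V j = tact V (i + j).
Proof.
have [le_pi|lt_ip] := leqP p i.
  by rewrite (tact_ge V le_pi) mul0mx tact_ge // (leq_trans le_pi) ?leq_addr.
have [le_pj|lt_jp] := leqP p j.
  by rewrite (tact_ge V le_pj) mulmx0 tact_ge // (leq_trans le_pj) ?leq_addl.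
rewrite (tactE V (Ordinal lt_ip)) (tactE V (Ordinal lt_jp)) mactM /=.
have [le_p|lt_p] := leqP p (i + j).
  rewrite tact_ge // big1 // => l _; rewrite gtn_eqF ?scale0r //.
  exact: leq_trans (ltn_ord l) le_p.
rewrite (tactE V (Ordinal lt_p)) (bigD1 (Ordinal lt_p)) //= eqxx scale1r.
rewrite big1 ?addr0 // => l; rewrite -val_eqE /= eq_sym => /negPf ->.
by rewrite scale0r.
Qed.

Lemma tact_hom V W (f : lin V W) i :
  mod_hom f -> f *m tact V i = tact W i *m f.
Proof.
by move=> hf; rewrite /tact; case: insubP => *; rewrite ?hf ?mulmx0 ?mul0mx.
Qed.

(** The successive drops of rank t^i decrease with i: the drop at i is
    dim (ker t \cap im t^i). *)
Lemma rank_tact_convex V i j : (i <= j)%N ->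
  (\rank (tact V i.+1) + \rank (tact V j)
     <= \rank (tact V i) + \rank (tact V j.+1))%N.
Proof.
elim: j => [|j IHj]; first by rewrite leqn0 => /eqP ->; rewrite addnC.
rewrite leq_eqVlt ltnS => /predU1P[-> | /IHj le_i]; first by rewrite addnC.
have := mxrank_Frobenius (tact V 1) (tact V j) (tact V 1).
rewrite !tactD !add1n !addn1; lia.
Qed.

(** The Jordan type s[1] + rho[p], rho = rank t^(p-1), told by its ranks. *)
Definition stably_trivial (s : nat) V : Prop :=
  \rank (tact V 1) = (p.-1 * \rank (tact V p.-1))%N /\
  mdim V = (s + p * \rank (tact V p.-1))%N.

(** The Jordan type [p-1] + rho[p], written with successors so as to avoid
    subtraction. *)
Definition stably_cotrivial V : Prop :=
  (\rank (tact V 1)).+1 = (p.-1 * (\rank (tact V p.-1)).+1)%N /\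
  (mdim V).+1 = (p * (\rank (tact V p.-1)).+1)%N.

Hypothesis p_gt1 : (1 < p)%N.

Lemma rank_tact0 V : \rank (tact V 0) = mdim V.
Proof. by rewrite tact0 ?mxrank1 // ltnW. Qed.

Lemma tactM_p V i j : (p <= i + j)%N -> tact V i *m tact V j = 0.
Proof. by move=> le_p; rewrite tactD tact_ge. Qed.

Lemma rank_tact_lower V j : (j <= p)%N ->
  (j * \rank (tact V p.-1) <= \rank (tact V (p - j)))%N.
Proof.
elim: j => // j IHj lt_jp; have /IHj le_j := ltnW lt_jp.
have le_i : (p - j.+1 <= p.-1)%N by lia.
have := rank_tact_convex V le_i.
rewrite prednK ?(ltnW p_gt1) // (tact_ge V (leqnn p)) mxrank0 addn0.
rewrite (_ : (p - j.+1).+1 = p - j)%N; last lia.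
rewrite mulSn; lia.
Qed.

(** The hypothesis bounds the first drop dim V - rank t by the last one
    rank t^(p-1).  By convexity all drops are then equal, i.e. all Jordan blocks
    have full size. *)
Lemma stably_trivial0_of_ker V :
  (forall v : 'cV_(mdim V), tact V p.-1 *m v = 0 ->
     exists w, v = tact V 1 *m w) -> stably_trivial 0 V.
Proof.
move=> /ker_sub_im_rank le_n.
have upper j : (j <= p)%N ->
    (\rank (tact V (p - j)) <= j * \rank (tact V p.-1))%N.
  elim: j => [|j IHj] lt_jp; first by rewrite subn0 tact_ge // mxrank0.
  have /IHj le_j := ltnW lt_jp.
  have := rank_tact_convex V (leq0n (p - j.+1)).
  rewrite rank_tact0 (_ : (p - j.+1).+1 = p - j)%N; last lia.
  rewrite mulSn; lia.
have e1 : (p - p.-1 = 1)%N by lia.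
have lp : (p.-1 <= p)%N by lia.
split.
  by have := upper _ lp; have := rank_tact_lower V lp; rewrite e1; lia.
have := upper _ (leqnn p); have := rank_tact_lower V (leqnn p).
by rewrite subnn rank_tact0 add0n; lia.
Qed.

Lemma stably_trivial0_ker1 V : stably_trivial 0 V ->
  forall v : 'cV_(mdim V), tact V 1 *m v = 0 ->
  exists w, v = tact V p.-1 *m w.
Proof.
case=> r1 d; apply: ker_sub_im; first by apply: tactM_p; lia.
rewrite r1 {1}d; move: (\rank _) => r; rewrite -[X in (_ <= _ + X)%N]mul1n.
rewrite -mulnDl add0n leq_mul2r; lia.
Qed.

Lemma stably_trivial0_kerp V : stably_trivial 0 V ->
  forall v : 'cV_(mdim V), tact V p.-1 *m v = 0 ->
  exists w, v = tact V 1 *m w.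
Proof.
case=> r1 d; apply: ker_sub_im; first by apply: tactM_p; lia.
rewrite r1 {1}d; move: (\rank _) => r; rewrite -[X in (_ <= X + _)%N]mul1n.
rewrite -mulnDl add0n leq_mul2r; lia.
Qed.

(** ker t \cap im t has dimension rank t - rank t^2, which equals rank t^(p-1)
    because blocks have size 1 or p only. *)
Lemma stably_trivial_socle s V (w : 'cV_(mdim V)) : stably_trivial s V ->
  tact V 1 *m (tact V 1 *m w) = 0 ->
  exists w', tact V 1 *m w = tact V p.-1 *m w'.
Proof.
case=> r1 d tw; set t := tact V 1 in r1 *; set r : nat := \rank (tact V p.-1) in r1 d.
have r2 : (p.-2 * r <= \rank (tact V 2))%N.
  have := @rank_tact_lower V p.-2; rewrite (_ : p - p.-2 = 2)%N; last lia.
  by apply; lia.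
have cap_rank := mxrank_mul_ker t^T t^T.
rewrite -trmx_mul tactD addn1 !mxrank_tr -/t in cap_rank.
apply/colspanP; have sub : ((tact V p.-1)^T <= t^T :&: kermx t^T)%MS.
  rewrite sub_capmx; apply/andP; split.
    by apply/colspanP; exists (tact V p.-2); rewrite tactD; congr tact; lia.
  by apply/sub_kermxP; rewrite -trmx_mul tactM_p ?trmx0 //; lia.
apply: (@submx_trans _ _ _ _ _ _ (t^T :&: kermx t^T)%MS).
  rewrite sub_capmx; apply/andP; split; first by apply/colspanP; exists w.
  by apply/sub_kermxP; rewrite -trmx_mul tw trmx0.
rewrite -(geq_leqif (mxrank_leqif_sup sub)) mxrank_tr -/r.
have : (p.-1 * r = p.-2 * r + r)%N by rewrite -{3}[r]mul1n -mulnDl; congr muln; lia.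
lia.
Qed.

(** S spans the socles of the blocks of size 1, a complement of im t^(p-1) in
    ker t. *)
Lemma stably_trivial_ker s V : stably_trivial s V ->
  exists S : 'M[K]_(mdim V, s), tact V 1 *m S = 0 /\
  forall v : 'cV_(mdim V), tact V 1 *m v = 0 ->
    exists c w, v = S *m c + tact V p.-1 *m w.
Proof.
case=> r1 d; set t := tact V 1; set B := tact V p.-1 in r1 d *.
have tB0 : t *m B = 0 by apply: tactM_p; lia.
have sB : (B^T <= kermx t^T)%MS.
  by apply/sub_kermxP; rewrite -trmx_mul tB0 trmx0.
set C := (kermx t^T :\: B^T)%MS.
have rC : \rank C = s.
  have := mxrank_cap_compl (kermx t^T) B^T.
  have -> : \rank (kermx t^T :&: B^T)%MS = \rank B.
    by rewrite -(mxrank_tr B); apply/eqmx_rank/eqmxP/capmx_idPr.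
  rewrite -/C mxrank_ker mxrank_tr r1.
  have : (p * \rank B = \rank B + p.-1 * \rank B)%N by rewrite -mulSn prednK // ltnW.
  lia.
rewrite -rC; exists (row_base C)^T; split.
  rewrite -[t]trmxK -trmx_mul (sub_kermxP _) ?trmx0 // eq_row_base.
  exact: diffmxSl.
move=> v tv; have : (v^T <= kermx t^T)%MS.
  by apply/sub_kermxP; rewrite -trmx_mul tv trmx0.
rewrite -(addsmx_diff_cap_eq (kermx t^T) B^T) => /sub_addsmxP[[a b] /= e].
have /submxP[c ec] : (a *m C <= row_base C)%MS by rewrite eq_row_base submxMl.
have /submxP[w ew] : (b *m (kermx t^T :&: B^T) <= B^T)%MS.
  exact: submx_trans (submxMl _ _) (capmxSr _ _).
exists c^T, w^T; rewrite -[v]trmxK e ec ew linearD /= !trmx_mul.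
by rewrite trmxK.
Qed.
End TAction.

(** * Isomorphisms, sums, Heller shifts and kernels *)

(** Consequence of the relations of [heller_ranks], u1 and up standing for the
    ranks of t and t^(p-1) on U; under either hypothesis q = up + wp + 1. *)
Lemma heller_arith p q dU dW u1 up w1 wp : (1 < p)%N ->
  (dU + dW = p * q)%N -> (u1 + q = wp + dU)%N -> (up + p.-1 * q = w1 + dU)%N ->
  ((w1 = p.-1 * wp)%N -> (dW = 1 + p * wp)%N ->
    (u1.+1 = p.-1 * up.+1)%N /\ (dU.+1 = p * up.+1)%N) /\
  ((w1.+1 = p.-1 * wp.+1)%N -> (dW.+1 = p * wp.+1)%N ->
    (u1 = p.-1 * up)%N /\ (dU = 1 + p * up)%N).
Proof.
case: p => // p _ /= e1 e2 e3; rewrite !mulSn in e1 *.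
split=> e4 e5; rewrite ?mulSn in e5; rewrite ?mulnS in e4 e5 *.
  have eq : q = (up + wp).+1 by lia.
  by move: e1 e2 e3; rewrite eq !mulnS !mulnDr; lia.
have eq : q = (up + wp).+1 by lia.
by move: e1 e2 e3; rewrite eq !mulnS !mulnDr; lia.
Qed.

Section ExactRanks.
Variables (K : fieldType) (p : nat).
Implicit Types U V W P L M N : fdmod (trunc_alg K p).

Lemma mod_iso_dim V W (f : lin V W) : mod_iso f -> mdim V = mdim W /\ \rank f = mdim V.
Proof.
case=> _ [g [fg gf]].
have := mxrankM_maxr g f.
have := mxrankM_maxl f g; have := rank_leq_row f; have := rank_leq_col f.
by rewrite fg gf !mxrank1; lia.
Qed.

Lemma mod_iso_rank V W (f : lin V W) i : mod_iso f ->
  \rank (tact V i) = \rank (tact W i).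
Proof.
move=> isof; have [dVW rf] := mod_iso_dim isof.
have := tact_hom i (proj1 isof) => /(congr1 (fun A => \rank A)).
by rewrite rank_mulmx_free // => ->; rewrite rank_mulmx_full // rf.
Qed.

Lemma stably_trivial_iso s V W (f : lin V W) : mod_iso f ->
  stably_trivial s V -> stably_trivial s W.
Proof.
move=> isof [r1 d]; have [dVW _] := mod_iso_dim isof.
by rewrite /stably_trivial -(mod_iso_rank 1 isof) -(mod_iso_rank p.-1 isof) -dVW.
Qed.

Lemma stably_trivial_dsum n (V : 'I_n -> fdmod (trunc_alg K p)) (s : 'I_n -> nat) :
  (forall j, stably_trivial (s j) (V j)) ->
  stably_trivial (\sum_j s j) (dsum V).
Proof.
move=> hV.
have rk i : \rank (tact (dsum V) i) = (\sum_j \rank (tact (V j) i))%N.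
  have [le_pi|lt_ip] := leqP p i.
    by rewrite tact_ge // mxrank0 big1 // => j _; rewrite tact_ge ?mxrank0.
  rewrite (tactE (dsum V) (Ordinal lt_ip)) rank_mxdiag.
  by apply: eq_bigr => j _; rewrite (tactE (V j) (Ordinal lt_ip)).
rewrite /stably_trivial !rk !big_distrr /= -big_split /=.
by split; apply: eq_bigr => j _; case: (hV j).
Qed.

Lemma stably_trivial_dsum2 V W s r :
  stably_trivial s V -> stably_trivial r W -> stably_trivial (s + r) (dsum2 V W).
Proof.
have rk i : \rank (tact (dsum2 V W) i) = (\rank (tact V i) + \rank (tact W i))%N.
  have [le_pi|lt_ip] := leqP p i; first by rewrite !tact_ge // !mxrank0.
  rewrite (tactE (dsum2 V W) (Ordinal lt_ip)) /= rank_diag_block_mx.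
  by rewrite (tactE V (Ordinal lt_ip)) (tactE W (Ordinal lt_ip)).
rewrite /stably_trivial !rk /= => [[r1 d1] [r2 d2]].
by rewrite !mulnDr r1 r2; split=> //; lia.
Qed.

Hypothesis p_gt1 : (1 < p)%N.

(** The stable type of Omega^a(k): [1] for a even, [p-1] for a odd. *)
Definition heller_parity (b : bool) V :=
  if b then stably_trivial 1 V else stably_cotrivial V.

Section HellerShift.
Variables (U P W : fdmod (trunc_alg K p)).
Variables (f : 'M[K]_(mdim P, mdim U)) (g : 'M[K]_(mdim W, mdim P)).
Hypotheses (ex : short_exact f g) (frP : stably_trivial 0 P).

Lemma heller_ranks :
  let q := \rank (tact P p.-1) in
  [/\ (mdim U + mdim W = p * q)%N,
      (\rank (tact U 1) + q = \rank (tact W p.-1) + mdim U)%N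
    & (\rank (tact U p.-1) + p.-1 * q = \rank (tact W 1) + mdim U)%N].
Proof.
have [hf hg rf rg [gf0 rgf]] := (short_exact_ranks f g).1 ex.
move: frP => [r1 d] q.
have pq : (p * q = q + p.-1 * q)%N by rewrite -mulSn prednK // ltnW.
have pair_rank i j : (i + j)%N = p -> (\rank (tact P i) + \rank (tact P j))%N = mdim P ->
    (\rank (tact U i) + \rank (tact P j) = \rank (tact W j) + mdim U)%N.
  move=> ij rij.
  have := rank_exact_pair (tactM_p P _) rij gf0 rgf; rewrite ij leqnn => /(_ isT).
  rewrite -(tact_hom i hf) (tact_hom j hg).
  by rewrite (rank_mulmx_free _ rf) (rank_mulmx_full _ rg) rf.
split; first by lia.
  by apply: pair_rank; rewrite ?r1; lia.
by rewrite -r1; apply: pair_rank; rewrite ?r1; lia.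
Qed.

Lemma heller_parity_ses b : heller_parity b W <-> heller_parity (~~ b) U.
Proof.
have [e1 e2 e3] := heller_ranks; rewrite /heller_parity.
have [tW cW] := heller_arith p_gt1 e1 e2 e3.
have [tU cU] : ((\rank (tact U 1) = p.-1 * \rank (tact U p.-1))%N ->
    (mdim U = 1 + p * \rank (tact U p.-1))%N -> stably_cotrivial W) /\
   (((\rank (tact U 1)).+1 = p.-1 * (\rank (tact U p.-1)).+1)%N ->
    (mdim U).+1 = (p * (\rank (tact U p.-1)).+1)%N -> stably_trivial 1 W).
  apply: (@heller_arith p (\rank (tact P p.-1)) (mdim W) (mdim U)) => //.
  - lia.
  - lia.
  have := e2; have : (p * \rank (tact P p.-1) = \rank (tact P p.-1) +
     p.-1 * \rank (tact P p.-1))%N by rewrite -mulSn prednK // ltnW.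
  lia.
by case: b; split=> -[e e']; [exact: tW|exact: cU|exact: cW|exact: tU].
Qed.

End HellerShift.

Lemma heller_parity_tower (T : tower (trunc_alg K p)) :
  (forall a, short_exact (tinc T a) (tprj T a)) ->
  (forall a, stably_trivial 0 (term T a)) ->
  stably_trivial 1 (syz T 0) ->
  forall a : int, heller_parity (2 %| a)%Z (syz T a).
Proof.
move=> ex fr h0.
have step a : heller_parity (2 %| a)%Z (syz T a) <->
              heller_parity (2 %| a + 1)%Z (syz T (a + 1)).
  rewrite (_ : (2 %| a + 1)%Z = ~~ (2 %| a)%Z); last by lia.
  exact: heller_parity_ses (ex a) (fr a) _.
elim/int_rect => [//|n IHn|n IHn].
  by rewrite (_ : n.+1%:Z = n%:Z + 1); [apply: (step n).1 | lia].
by apply: (step _).2; rewrite (_ : - n.+1%:Z + 1 = - n%:Z); last lia.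
Qed.

(** For p = 2 the types [1] and [p-1] coincide. *)
Lemma heller_parity2 b V : p = 2%N -> heller_parity b V -> stably_trivial 1 V.
Proof.
move=> p2; case: b => //; rewrite /= /stably_cotrivial /stably_trivial.
rewrite (_ : p.-1 = 1%N); last by rewrite p2.
have : (p * \rank (tact V 1) = \rank (tact V 1) + \rank (tact V 1))%N.
  by rewrite {1}p2 mul2n addnn.
rewrite mulnS; lia.
Qed.

Section Kernel.
Variables (s r : nat) (L M N : fdmod (trunc_alg K p)).
Variables (f : 'M[K]_(mdim M, mdim L)) (g : 'M[K]_(mdim N, mdim M)).
Hypotheses (ex : short_exact f g).
Hypothesis le_rs : (r <= s)%N.
Hypotheses (trM : stably_trivial s M) (trN : stably_trivial r N).

(** ker t^(p-1) = ker t + im t: if t^(j+1) z = 0 then t^j z lies in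
    ker t \cap im t = im t^(p-1), so that z can be corrected by an element of
    im t to be killed by t^j. *)
Lemma stably_trivial_ker_pred (z : 'cV_(mdim N)) : tact N p.-1 *m z = 0 ->
  exists y w, z = y + tact N 1 *m w /\ tact N 1 *m y = 0.
Proof.
suff h j : (j < p)%N -> forall z : 'cV_(mdim N), tact N j *m z = 0 ->
    exists y w, z = y + tact N 1 *m w /\ tact N 1 *m y = 0.
  by apply: h; lia.
elim: j => [|[|j] IHj] lt_jp {}z.
- rewrite tact0 ?mul1mx => [-> | ]; last by lia.
  by exists 0, 0; rewrite !mulmx0 addr0.
- by move=> tz; exists z, 0; rewrite mulmx0 addr0.
move=> tz.
have [] := @stably_trivial_socle _ _ p_gt1 _ _ (tact N j *m z) trN.
  by rewrite !mulmxA !tactD !add1n.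
rewrite mulmxA tactD add1n => w ew.
have [||y [w' [e ty]]] := IHj _ (z - tact N (p.-1 - j.+1) *m w); first by lia.
  rewrite mulmxBr ew mulmxA tactD (_ : (j.+1 + (p.-1 - j.+1) = p.-1)%N) ?subrr //.
  by lia.
exists y, (w' + tact N (p.-1 - j.+2) *m w); split=> //.
rewrite mulmxDr addrA -e mulmxA tactD (_ : (1 + (p.-1 - j.+2) = p.-1 - j.+1)%N).
  by rewrite subrK.
lia.
Qed.

Hypothesis lift_fix : forall z : 'cV_(mdim N), tact N 1 *m z = 0 ->
  exists y w, tact M 1 *m y = 0 /\ z = g *m y + tact N p.-1 *m w.

(** As ker t^i of M maps onto ker t^i of N for i = 1 and i = p-1, ranks of t^i
    are additive for these two i, which determine the stable type. *)
Lemma kernel_stably_trivial : stably_trivial (s - r) L.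
Proof.
have [hf hg rf rg [gf0 rgf]] := (short_exact_ranks f g).1 ex.
have sg : lin_surj g by apply/lin_surjP.
have lift1 (z : 'cV_(mdim N)) : tact N 1 *m z = 0 ->
    exists y, z = g *m y /\ tact M 1 *m y = 0.
  move=> /lift_fix[y [w [ty ->]]]; have [x ->] := sg w.
  exists (y + tact M p.-1 *m x); split.
    by rewrite mulmxDr !mulmxA (tact_hom _ hg).
  by rewrite mulmxDr ty mulmxA tactM_p ?mul0mx ?addr0 //; lia.
have liftp (z : 'cV_(mdim N)) : tact N p.-1 *m z = 0 ->
    exists y, z = g *m y /\ tact M p.-1 *m y = 0.
  move=> /stably_trivial_ker_pred[y [w [-> /lift1[y' [-> ty']]]]].
  have [x ->] := sg w.
  exists (y' + tact M 1 *m x); split.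
    by rewrite mulmxDr !mulmxA (tact_hom _ hg).
  rewrite mulmxDr (_ : p.-1 = p.-2 + 1)%N; last lia.
  by rewrite -tactD -!mulmxA ty' mulmx0 !mulmxA !tactD add0r tact_ge ?mul0mx //; lia.
have rk i : (forall z : 'cV_(mdim N), tact N i *m z = 0 ->
     exists y, z = g *m y /\ tact M i *m y = 0) ->
   (\rank (tact L i) + \rank (tact N i) = \rank (tact M i))%N.
  move=> lift; set C := cokermx (tact M i).
  have tC : tact M i *m C = 0 by apply: mulmx_coker.
  have rC : (\rank C + \rank (tact M i))%N = mdim M.
    by rewrite mxrank_coker subnK // rank_leq_col.
  have := rank_exact_pair tC _ gf0 rgf; rewrite addnC rC => /(_ erefl).
  rewrite -(tact_hom i hf) (rank_mulmx_free _ rf) rf.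
  have tgC : tact N i *m (g *m C) = 0.
    by rewrite mulmxA -(tact_hom i hg) -mulmxA tC mulmx0.
  have := mulmx0_rank_max tgC.
  have : (mdim N <= \rank (tact N i) + \rank (g *m C))%N.
    apply: ker_sub_im_rank => z /lift[y [-> ty]].
    have [|x ->] := ker_sub_im tC _ ty; first by rewrite addnC rC.
    by exists x; rewrite mulmxA.
  lia.
have r1 := rk 1%N lift1; have rp := rk p.-1 liftp.
case: trM trN => [m1 dM] [n1 dN]; split.
  by apply/eqP; rewrite -(eqn_add2r (\rank (tact N 1))) r1 m1 -rp mulnDr n1.
suff : (mdim L + r = s + p * \rank (tact L p.-1))%N by lia.
have : (p * \rank (tact M p.-1) =
   p * \rank (tact L p.-1) + p * \rank (tact N p.-1))%N by rewrite -mulnDr rp.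
lia.
Qed.
End Kernel.
End ExactRanks.

(** * Decomposition into Jordan blocks *)

Lemma mod_hom_mxrow (K : fieldType) (A : fdalg K) n (V : 'I_n -> fdmod A)
    (W : fdmod A) (h : forall j, lin (V j) W) :
  (forall j, mod_hom (h j)) -> mod_hom (\mxrow_j h j : lin (dsum V) W).
Proof.
move=> hh i; rewrite [mact (dsum V) i]/= /dsum_act mul_mxrow_mxdiag mul_mxrow.
by apply: eq_mxrow => j; apply: hh.
Qed.

Lemma mxrow_block_span (K : fieldType) m n (q : 'I_n -> nat)
    (B : forall j, 'M[K]_(m, q j)) j :
  exists D, B j = (\mxrow_j B j) *m D.
Proof.
exists (submxrow 1%:M j); rewrite /submxrow mulmx_colsub mulmx1.
by rewrite -/(submxrow (\mxrow_j B j) j) mxrowK.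
Qed.

Lemma mod_iso_of_surj (K : fieldType) (A : fdalg K) (V W : fdmod A)
    (g : lin V W) :
  mod_hom g -> lin_surj g -> mdim V = mdim W -> isomorphic W V.
Proof.
move=> hg /lin_surjP rg dVW.
have ff : row_free g by rewrite /row_free rg.
have fu : row_full g by rewrite /row_full rg dVW.
exists (pinvmx g); split; last by exists g; rewrite mulVpmx ?mulmxVp.
move=> i; rewrite -[LHS]mulmx1 -(mulmxVp ff) -mulmxA [mact W i *m _]mulmxA.
by rewrite -hg !mulmxA mulVpmx // mul1mx.
Qed.

Section Classification.
Variables (K : fieldType) (p : nat).
Hypothesis p_gt1 : (1 < p)%N.
Implicit Type V : fdmod (trunc_alg K p).

(** The map [i.+1] -> V sending the generator 1 to w. *)
Definition orbit_mx V (i : 'I_p) (w : 'cV_(mdim V)) : lin (jordan_block K i) V :=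
  \matrix_(r < mdim V, c < i.+1) (tact V c *m w) r 0.

Lemma orbit_mx_hom V (i : 'I_p) (w : 'cV_(mdim V)) :
  tact V i.+1 *m w = 0 -> mod_hom (orbit_mx i w).
Proof.
move=> tw l; apply/matrixP => r c; rewrite !mxE.
transitivity ((tact V (l + c) *m w) r 0); last first.
  rewrite -tactD -mulmxA !mxE (tactE V l).
  by apply: eq_bigr => x _; rewrite !mxE.
under eq_bigr => x _ do rewrite !mxE.
have [lt_lc|le_lc] := ltnP (l + c) i.+1.
  rewrite (bigD1 (Ordinal lt_lc)) //= eqxx mulr1 [X in _ + X]big1 ?addr0 ?mxE // => x.
  by rewrite -val_eqE /= eq_sym => /negPf ->; rewrite mulr0.
rewrite big1 => [|x _]; last by rewrite gtn_eqF ?mulr0 // (leq_trans (ltn_ord x)).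
by rewrite -(subnK le_lc) -tactD -mulmxA tw mulmx0 mxE.
Qed.

(** The columns of X i generate the a i blocks of size i.+1.  The second
    hypothesis says that V is spanned by their orbits, spanning being tested
    against the column space of an arbitrary matrix g. *)
Lemma jordan_type_of_generators V (a : 'I_p -> nat)
    (X : forall i, 'M[K]_(mdim V, a i)) :
  (forall i : 'I_p, tact V i.+1 *m X i = 0) ->
  (forall q (g : 'M[K]_(mdim V, q)),
     (forall (i : 'I_p) j (c : 'cV_(a i)), (j <= i)%N ->
        exists d, tact V j *m X i *m c = g *m d) ->
     forall y : 'cV_(mdim V), exists d, y = g *m d) ->
  mdim V = (\sum_i a i * i.+1)%N ->
  jordan_type V a.
Proof.
move=> tX spanX dV.
pose h i : lin (dsum (fun _ : 'I_(a i) => jordan_block K i)) V :=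
  \mxrow_c orbit_mx i (col c (X i)).
pose g : lin (dsum (fun i => dsum (fun _ : 'I_(a i) => jordan_block K i))) V :=
  \mxrow_i h i.
apply: (@mod_iso_of_surj _ _ _ _ g).
- apply: mod_hom_mxrow => i; apply: mod_hom_mxrow => c; apply: orbit_mx_hom.
  by rewrite colE mulmxA tX mul0mx.
- apply: spanX => i j c le_ji.
  have [D eD] := mxrow_block_span h i.
  suff [E ->] : exists E, tact V j *m X i = h i *m E.
    by exists (D *m E *m c); rewrite eD !mulmxA.
  apply/colspanP/row_subP => l; rewrite -tr_col.
  apply/colspanP; rewrite colE -mulmxA -colE.
  have [F eF] := mxrow_block_span (fun c => orbit_mx i (col c (X i))) l.
  exists (F *m delta_mx (Ordinal (le_ji : (j < i.+1)%N)) 0).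
  rewrite mulmxA -eF -colE; apply/matrixP => r z; rewrite !mxE ord1.
  by apply: eq_bigr => x _; rewrite !mxE.
rewrite dV; apply: eq_bigr => i _ /=.
by rewrite sum_nat_const card_ord.
Qed.

(** Generators of the blocks of size p are columns whose images under t^(p-1)
    form a basis of im t^(p-1); the blocks of size 1 come from a complement of
    im t^(p-1) in ker t.  They span: by induction on j they span ker t^j, since
    for j > 0 a vector t^j y of ker t is in im t^(p-1), and y can be corrected
    by an element of the blocks of size p. *)
Lemma jordan_type_of_stably_trivial s r V (a : 'I_p -> nat) :
  stably_trivial s V -> \rank (tact V p.-1) = r ->
  (forall i : 'I_p, a i = if i == 0 :> nat then s else
                          if i == p.-1 :> nat then r else 0%N) ->
  jordan_type V a.
Proof.
move=> trV rV aE.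
have Xex (i : 'I_p) : exists X : 'M[K]_(mdim V, a i),
   [/\ tact V i.+1 *m X = 0,
       i = 0 :> nat -> forall v : 'cV_(mdim V), tact V 1 *m v = 0 ->
         exists c w, v = X *m c + tact V p.-1 *m w
     & i = p.-1 :> nat -> exists Y, tact V p.-1 = tact V p.-1 *m X *m Y].
  move: (aE i); case: eqP => [i0|n0].
    have [S [tS spS]] := stably_trivial_ker p_gt1 trV.
    move=> ->; exists S; rewrite i0; split=> // e; lia.
  case: eqP => [ip|np] ->; last by exists 0; rewrite mulmx0.
  rewrite -rV; set B := tact V p.-1.
  exists (pinvmx (row_base B)); split=> //.
    by rewrite ip prednK ?tact_ge ?mul0mx //; lia.
  by exists (row_base B); rewrite mulmxKpV // eq_row_base.
have [X hX] := fin_all_exists Xex.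
apply: (@jordan_type_of_generators _ _ X) => [i|q g hg|]; first by case: (hX i).
  have lt0p : (0 < p)%N by lia.
  have ltpp : (p.-1 < p)%N by lia.
  pose i0 := Ordinal lt0p; pose ip := Ordinal ltpp.
  have [_ /(_ erefl) spS _] := hX i0; have [_ _ /(_ erefl) [Y eY]] := hX ip.
  have span_p j (w : 'cV_(mdim V)) : (j <= p.-1)%N ->
      exists d, tact V j *m X ip *m Y *m w = g *m d.
    by move=> le_j; have := hg ip j (Y *m w) le_j; rewrite !mulmxA.
  suff h j : (j <= p)%N -> forall y : 'cV_(mdim V), tact V j *m y = 0 ->
      exists d, y = g *m d.
    by move=> y; apply: (h p) => //; rewrite tact_ge ?mul0mx.
  elim: j => [|[|j] IHj] le_jp y.
  - by rewrite tact0 // mul1mx => ->; exists 0; rewrite mulmx0.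
  - move=> /spS[c [w ->]].
    have [d1 e1] := hg i0 0%N c isT; rewrite tact0 ?mul1mx // in e1.
    have [d2 e2] := span_p p.-1 w (leqnn _); rewrite -eY in e2.
    by exists (d1 + d2); rewrite mulmxDr -e1 -e2.
  move=> ty; have [] := @stably_trivial_socle _ _ p_gt1 s _ (tact V j *m y) trV.
    by rewrite !mulmxA !tactD !add1n.
  rewrite mulmxA tactD add1n eY => w ew.
  set x := X ip *m Y *m w.
  have [|d ed] := span_p (p.-1 - j.+1)%N w; first by lia.
  have [||d' ed'] := IHj _ (y - tact V (p.-1 - j.+1) *m x); first by lia.
    rewrite mulmxBr ew (mulmxA (tact V j.+1)) tactD subnKC; last by lia.
    by rewrite /x !mulmxA subrr.
  exists (d' + d); rewrite mulmxDr -ed -ed' /x !mulmxA.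
  by rewrite subrK.
have lt0p : (0 < p)%N by lia.
have ltpp : (p.-1 < p)%N by lia.
case: trV => _ ->; rewrite rV (bigD1 (Ordinal lt0p)) // (bigD1 (Ordinal ltpp)).
  rewrite big1 => [|i]; last first.
    rewrite -!val_eqE /= => /andP[/negPf n0 /negPf np].
    by rewrite aE n0 np mul0n.
  rewrite !aE /= eqxx muln1 gtn_eqF; last by lia.
  by rewrite prednK // addn0 mulnC.
by rewrite -val_eqE /= gtn_eqF //; lia.
Qed.
End Classification.

(** * Projective modules become free at pi-points *)

(** The residue field of K[t]/t^p, over the opposite algebra because flatness is
    tested on right modules. *)
Section ResidueModule.
Variables (K : fieldType) (p : nat).
Hypothesis p_gt0 : (0 < p)%N.
Local Notation Aop := (op_alg (trunc_alg K p)).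

Let ract (i : 'I_(adim Aop)) : 'M[K]_1 := (i == 0 :> nat)%:R%:M.

Fact residue_actM i j : ract i *m ract j = \sum_l amul i j l *: ract l.
Proof.
rewrite (bigD1 (Ordinal p_gt0 : 'I_(adim Aop))) //= big1 => [|l]; last first.
  by rewrite -val_eqE /ract /= => /negPf ->; rewrite raddf0 scaler0.
rewrite addr0 /ract -scalar_mxM eqxx scale_scalar_mx mulr1 -natrM mulnb.
by rewrite addn_eq0 andbC.
Qed.

Fact residue_act1 : \sum_i aone i *: ract i = 1%:M.
Proof.
rewrite (bigD1 (Ordinal p_gt0 : 'I_(adim Aop))) //= big1 => [|l]; last first.
  by rewrite -val_eqE /ract /= => /negPf ->; rewrite scale0r.
by rewrite addr0 /ract eqxx scale1r.
Qed.

Definition residue_mod : fdmod Aop := FdMod residue_actM residue_act1.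
End ResidueModule.

(** Tensoring the inclusion K -> K[t]/t^p, 1 |-> t^(p-1), with Y gives
    multiplication by t^(p-1) from Y/tY to Y; its injectivity is
    ker t^(p-1) \subset im t. *)
Lemma flat_stably_trivial (K : fieldType) (p : nat) (Y : fdmod (trunc_alg K p)) :
  (1 < p)%N -> flat Y -> stably_trivial 0 Y.
Proof.
move=> p_gt1 flY; apply: stably_trivial0_of_ker => // v tv.
have p_gt0 : (0 < p)%N by lia.
have ltpp : (p.-1 < p)%N by lia.
pose ip : 'I_(adim (trunc_alg K p)) := Ordinal ltpp.
pose i0 : 'I_(adim (trunc_alg K p)) := Ordinal p_gt0.
pose X := residue_mod K p_gt0.
pose f : 'M[K]_(mdim (regular (op_alg (trunc_alg K p))), mdim X) :=
  delta_mx ip 0.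
have hf : mod_hom (V := X) (W := regular _) f.
  move=> i; rewrite mul_mx_scalar; apply/matrixP => l z.
  rewrite !mxE (bigD1 ip) //= big1 => [|x /negPf nx]; last first.
    by rewrite !mxE nx mulr0.
  rewrite !mxE eqxx (ord1 z) eqxx /= andbT mulr1 addr0 -natrM mulnb.
  congr (nat_of_bool _)%:R; rewrite -val_eqE /=.
  by have := ltn_ord l; have := ltn_ord i; rewrite /=; lia.
have injf : lin_inj f.
  move=> w /matrixP/(_ ip 0); rewrite !mxE big_ord_recl big_ord0 !mxE !eqxx.
  by rewrite mul1r addr0 => e; apply/matrixP => a b; rewrite !ord1 e mxE.
have [|S eS] := flY X _ f hf injf v^T.
  (* e_(p-1) (x) v = e_0 t^(p-1) (x) v = e_0 (x) t^(p-1) v = 0 *)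
  exists (fun i => if i == p.-1 :> nat then delta_mx i0 0 *m v^T else 0).
  rewrite (bigD1 ip) //= [X in _ + X]big1 => [|i]; last first.
    by rewrite -val_eqE /= => /negPf ->; rewrite mulmx0 mul0mx subr0.
  rewrite eqxx -mulmxA -trmx_mul -(tactE Y ip) tv trmx0 mulmx0 subr0 addr0 mulmxA.
  congr (_ *m _); apply/matrixP => l z; rewrite -colE !mxE (ord1 z) andbT /=.
  by rewrite eq_sym.
exists (- \sum_(i < p | i != i0) tact Y i.-1 *m (S i)^T).
rewrite -[v]trmxK eS (bigD1 i0) //= linearD /= [X in X + _]linearB /=.
rewrite mul1mx trmx_mul trmxK -(tactE Y i0) /= tact0 // mul1mx subrr add0r.
rewrite mulmxN mulmx_sumr raddf_sum -sumrN; apply: eq_bigr => i.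
rewrite -val_eqE /= => ni; rewrite linearB /= (negPf ni).
rewrite raddf0 mul0mx trmx0 sub0r trmx_mul trmxK mulmxA tactD add1n prednK ?lt0n //.
by rewrite tactE.
Qed.

Section DualBasis.
Variables (k : fieldType) (A : fdalg k).

(** The map A -> P sending 1 to the j-th basis vector. *)
Definition orbit_map (P : fdmod A) (j : 'I_(mdim P)) : lin (regular A) P :=
  \matrix_(x < mdim P, i < adim A) mact P i x j.

Lemma orbit_map_hom (P : fdmod A) (j : 'I_(mdim P)) : mod_hom (orbit_map j).
Proof.
move=> i; apply/matrixP => x y; rewrite !mxE.
transitivity ((mact P i *m mact P y) x j); last first.
  by rewrite mxE; apply: eq_bigr => z _; rewrite !mxE.
rewrite mactM summxE; apply: eq_bigr => z _; rewrite !mxE mulrC //.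
Qed.

(** A projective module is a summand of a free one, here in terms of the
    components of the inclusion and of the projection. *)
Lemma projective_dual_basis (P : fdmod A) : projective P ->
  exists (s : 'I_(mdim P) -> lin P (regular A))
         (r : 'I_(mdim P) -> lin (regular A) P),
  [/\ forall j, mod_hom (s j), forall j, mod_hom (r j)
    & \sum_j r j *m s j = 1%:M].
Proof.
move=> prP; pose F := dsum (fun _ : 'I_(mdim P) => regular A).
pose g : lin F P := \mxrow_j orbit_map j.
have hg : mod_hom g by apply: mod_hom_mxrow => j; apply: orbit_map_hom.
have sg : lin_surj g.
  move=> w; exists (\mxcol_j (\col_i (aone i * w j 0))).
  rewrite mul_mxrow_mxcol -[LHS]mul1mx -(mact1 P).
  apply/matrixP => x z; rewrite ord1 mxE summxE.
  apply: eq_bigr => j _; rewrite !mxE summxE mulr_suml.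
  by apply: eq_bigr => i _; rewrite !mxE mulrCA mulrA.
have [h [hh gh]] := prP F P g 1%:M hg sg (fun i => etrans (mul1mx _) (esym (mulmx1 _))).
exists (fun j => submxcol h j), (@orbit_map P); split.
- move=> j i; move: (hh i); rewrite -[h]submxcolK mxcol_mul [mact F i]/= /dsum_act.
  by rewrite mul_mxdiag_mxcol => /eq_mxcolP/(_ j); rewrite mxcolK.
- exact: orbit_map_hom.
by rewrite -gh -{2}[h]submxcolK mul_mxrow_mxcol.
Qed.
End DualBasis.

Lemma map_mxdiag (R S : nmodType) (h : R -> S) n (q : 'I_n -> nat)
    (B : forall j, 'M[R]_(q j)) : h 0 = 0 ->
  map_mx h (\mxdiag_j B j) = \mxdiag_j map_mx h (B j).
Proof.
move=> h0; rewrite /mxdiag.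
transitivity (\mxblock_(i, j) map_mx h
    (if i == j then conform_mx 0 (B i) else 0 : 'M_(q i, q j))).
  by apply/matrixP => x y; rewrite !mxE.
apply/eq_mxblock => i j; case: eqVneq => [->|_]; rewrite ?conform_mx_id //.
by apply/matrixP => x y; rewrite !mxE.
Qed.

Section PiRestriction.
Variables (k : fieldType) (G : fin_group_scheme k) (p : nat) (pi : pi_point G p).
Implicit Types V W P : fdmod (group_alg G).
Local Notation iota := (pext pi).

Lemma pi_restrict_hom V W (f : lin V W) : mod_hom f ->
  mod_hom (map_mx iota f : lin (pi_restrict pi V) (pi_restrict pi W)).
Proof.
move=> hf i; rewrite /= /restrict_act mulmx_sumr mulmx_suml.
apply: eq_bigr => b _ /=; rewrite -scalemxAl -scalemxAr -!map_mxM.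
by rewrite (hf b).
Qed.

Lemma pi_restrict_iso V W (f : lin V W) : mod_iso f ->
  mod_iso (map_mx iota f : lin (pi_restrict pi V) (pi_restrict pi W)).
Proof.
case=> hf [g [fg gf]]; split; first exact: pi_restrict_hom.
by exists (map_mx iota g); rewrite -!map_mxM fg gf !map_mx1.
Qed.

Lemma pi_restrict_short_exact U V W (f : lin U V) (g : lin V W) :
  short_exact f g ->
  short_exact (map_mx iota f : lin (pi_restrict pi U) (pi_restrict pi V))
              (map_mx iota g : lin (pi_restrict pi V) (pi_restrict pi W)).
Proof.
move=> /short_exact_ranks[hf hg rf rg [gf0 rgf]]; apply/short_exact_ranks.
split; try exact: pi_restrict_hom; rewrite ?mxrank_map //.
by rewrite -map_mxM gf0 map_mx0.
Qed.

Lemma pi_restrict_dsum n (V : 'I_n -> fdmod (group_alg G)) :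
  mod_iso (1%:M : lin (dsum (fun j => pi_restrict pi (V j)))
                      (pi_restrict pi (dsum V))).
Proof.
split; last by exists 1%:M; rewrite mulmx1.
move=> i; rewrite mul1mx mulmx1 /= /dsum_act /restrict_act mxdiag_sum /=.
apply: eq_bigr => b _; rewrite map_mxdiag ?rmorph0 //.
pose c := am (Defs.pmap pi) b i.
have cE n1 n2 (C : 'M_(n1, n2)) : c *: C = map_mx ( *%R c) C.
  by apply/matrixP => x y; rewrite !mxE.
rewrite -/c cE map_mxdiag ?mulr0 //.
by apply: eq_mxdiag => j; rewrite cE.
Qed.

Lemma pi_restrict_dsum2 V W :
  mod_iso (1%:M : lin (dsum2 (pi_restrict pi V) (pi_restrict pi W))
                      (pi_restrict pi (dsum2 V W))).
Proof.
split; last by exists 1%:M; rewrite mulmx1.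
move=> i; rewrite mul1mx mulmx1 /= /dsum2_act /restrict_act /=.
apply: (big_rec3 (fun x y z => block_mx x 0 0 y = z)).
  exact: (@block_mx0 _ (mdim V) (mdim W) (mdim V) (mdim W)).
move=> b x y z _ <-.
by rewrite map_block_mx !map_mx0 scale_block_mx !scaler0 add_block_mx !addr0.
Qed.

Lemma pi_restrict_regular :
  mod_iso (1%:M : lin (restrict (Defs.pmap pi) (regular (bc_alg iota (group_alg G))))
                      (pi_restrict pi (regular (group_alg G)))).
Proof.
split; last by exists 1%:M; rewrite mulmx1.
move=> i; rewrite mul1mx mulmx1 /= /restrict_act /=.
by apply: eq_bigr => b _; congr (_ *: _); apply/matrixP => x y; rewrite !mxE.
Qed.

Lemma pi_restrict_projective P : (1 < p)%N ->
  projective P -> stably_trivial 0 (pi_restrict pi P).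
Proof.
move=> p_gt1 /projective_dual_basis[s [r [hs hr rs1]]].
apply: stably_trivial0_of_ker => // v tv.
have frR : stably_trivial 0 (pi_restrict pi (regular (group_alg G))).
  apply: stably_trivial_iso pi_restrict_regular _.
  exact: flat_stably_trivial p_gt1 (@pflat _ _ _ pi).
have /fin_all_exists[w ew] j : exists w, map_mx iota (s j) *m v =
    tact (pi_restrict pi (regular (group_alg G))) 1 *m w.
  apply: (stably_trivial0_kerp p_gt1 frR).
  by rewrite mulmxA -(tact_hom _ (pi_restrict_hom (hs j))) -mulmxA tv mulmx0.
exists (\sum_j map_mx iota (r j) *m w j).
rewrite -[LHS]mul1mx -(map_mx1 iota) -rs1 raddf_sum mulmx_suml mulmx_sumr.
apply: eq_bigr => j _; rewrite /= map_mxM -mulmxA ew !mulmxA.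
by rewrite (tact_hom _ (pi_restrict_hom (hr j))).
Qed.

(** t acts on a line by a nilpotent scalar, hence by 0. *)
Lemma pi_restrict_trivial : (1 < p)%N ->
  stably_trivial 1 (pi_restrict pi (trivial_mod G)).
Proof.
move=> p_gt1; set V := pi_restrict _ _.
suff t0 i : (0 < i)%N -> tact V i = 0.
  by split; rewrite !t0 ?mxrank0 ?muln0 //; lia.
move=> i_gt0; pose x := tact V i 0 0.
have tn n : tact V (i * n) = (x ^+ n)%:M.
  elim: n => [|n IHn]; first by rewrite muln0 tact0 //; lia.
  rewrite mulnS -tactD IHn exprS scalar_mxM; congr (_ *m _).
  exact: mx11_scalar.
have := tn p; rewrite tact_ge; last by rewrite leq_pmull.
move=> /matrixP/(_ 0 0); rewrite !mxE eqxx mulr1n => /esym/eqP.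
rewrite expf_eq0 => /andP[_ /eqP x0].
by rewrite [tact V i]mx11_scalar -/x x0 raddf0.
Qed.
End PiRestriction.

(** * The functor ker t / im t^(p-1) *)

Section SocleClasses.
Variables (K : fieldType) (p : nat).
Implicit Types V W : fdmod (trunc_alg K p).

(** Equality modulo im t^(p-1), hence in ker t / im t^(p-1) for vectors killed
    by t. *)
Definition norm_cong V (u v : 'cV[K]_(mdim V)) : Prop :=
  exists w, u - v = tact V p.-1 *m w.

Lemma norm_cong_refl V (u : 'cV_(mdim V)) : norm_cong u u.
Proof. by exists 0; rewrite subrr mulmx0. Qed.

Lemma norm_cong_sym V (u v : 'cV_(mdim V)) : norm_cong u v -> norm_cong v u.
Proof. by case=> w e; exists (- w); rewrite mulmxN -e opprB. Qed.

Lemma norm_cong_trans V (u v w : 'cV_(mdim V)) :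
  norm_cong u v -> norm_cong v w -> norm_cong u w.
Proof.
by case=> x ex [y ey]; exists (x + y); rewrite mulmxDr -ex -ey subrKA.
Qed.

Lemma norm_cong_add V (u v u' v' : 'cV_(mdim V)) :
  norm_cong u v -> norm_cong u' v' -> norm_cong (u + u') (v + v').
Proof.
by case=> x ex [y ey]; exists (x + y); rewrite mulmxDr -ex -ey opprD addrACA.
Qed.

Lemma norm_cong_scale V c (u v : 'cV_(mdim V)) :
  norm_cong u v -> norm_cong (c *: u) (c *: v).
Proof. by case=> x e; exists (c *: x); rewrite -scalemxAr -e scalerBr. Qed.

Lemma norm_cong_sum V (I : finType) (u v : I -> 'cV_(mdim V)) :
  (forall i, norm_cong (u i) (v i)) -> norm_cong (\sum_i u i) (\sum_i v i).
Proof.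
move=> h; elim/big_rec2: _ => [|i x y _ IH]; first exact: norm_cong_refl.
exact: norm_cong_add.
Qed.

Hypothesis p_gt1 : (1 < p)%N.

(** Maps through a free module Q vanish on ker t / im t^(p-1), since
    ker t = im t^(p-1) in Q. *)
Lemma norm_cong_via_free V W Q (a : lin V Q) (b : lin Q W) (u : 'cV_(mdim V)) :
  mod_hom a -> mod_hom b -> stably_trivial 0 Q -> tact V 1 *m u = 0 ->
  norm_cong (b *m a *m u) 0.
Proof.
move=> ha hb frQ tu.
have [|w ew] := stably_trivial0_ker1 p_gt1 frQ (_ : tact Q 1 *m (a *m u) = 0).
  by rewrite mulmxA -(tact_hom _ ha) -mulmxA tu mulmx0.
by exists (b *m w); rewrite subr0 -mulmxA ew !mulmxA (tact_hom _ hb).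
Qed.

(** ker t / im t^(p-1) is a line for the stable type [1]. *)
Lemma socle_line V : stably_trivial 1 V ->
  (exists w : 'cV_(mdim V), tact V 1 *m w = 0 /\ ~ norm_cong w 0) /\
  forall w u : 'cV_(mdim V), tact V 1 *m w = 0 -> ~ norm_cong w 0 ->
    tact V 1 *m u = 0 -> exists c, norm_cong u (c *: w).
Proof.
move=> trV; have [S [tS spS]] := stably_trivial_ker p_gt1 trV.
have span u : tact V 1 *m u = 0 -> exists c, norm_cong u (c *: S).
  move=> /spS[c [x ->]]; exists (c 0 0); exists x.
  by rewrite {1}[c]mx11_scalar mul_mx_scalar addrC addKr.
split=> [|w u tw nw tu].
  exists S; split=> // S0; case: (trV) => r1 d.
  have /ker_sub_im_rank : forall v : 'cV_(mdim V), tact V 1 *m v = 0 ->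
      exists x, v = tact V p.-1 *m x.
    move=> v /span[c /norm_cong_trans]; case/(_ (c *: 0) (norm_cong_scale c S0)) => x e.
    by exists x; rewrite -e scaler0 subr0.
  rewrite r1; move: d; have : (p * \rank (tact V p.-1) =
    \rank (tact V p.-1) + p.-1 * \rank (tact V p.-1))%N.
    by rewrite -mulSn prednK // ltnW.
  lia.
have [c cw] := span w tw; have [d du] := span u tu; exists (d / c).
have c0 : c != 0 by apply/eqP => c0; apply: nw; rewrite c0 scale0r in cw.
apply: norm_cong_trans du _; apply: norm_cong_sym.
by have := norm_cong_scale (d / c) cw; rewrite scalerA divfK.
Qed.
End SocleClasses.

(** * Action of Tate cohomology classes *)

Section TowerClasses.
Variables (K : fieldType) (p : nat) (T : tower (trunc_alg K p)).
Hypothesis p_gt1 : (1 < p)%N.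
Hypothesis exT : forall a, short_exact (tinc T a) (tprj T a).
Hypothesis frT : forall a, stably_trivial 0 (term T a).

(** Classes of ker t / im t^(p-1) on the syzygy syz a are represented by vectors
    of term a, where graded maps can be applied to them directly. *)
Definition is_class a (u : 'cV[K]_(mdim (term T a))) : Prop :=
  tact (syz T a) 1 *m (tprj T a *m u) = 0.

Definition class_eq a (u v : 'cV[K]_(mdim (term T a))) : Prop :=
  norm_cong (V := syz T a) (tprj T a *m u) (tprj T a *m v).

Definition nonzero_class a (u : 'cV[K]_(mdim (term T a))) : Prop :=
  is_class u /\ ~ class_eq u 0.

Definition acts_on_classes (s : int) (h : graded_map T) : Prop :=
  forall a b : int, a = b + s ->
    (forall u, is_class u -> is_class (h a b *m u)) /\
    (forall u v, class_eq u v -> class_eq (h a b *m u) (h a b *m v)).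

Let inc_hom a : mod_hom (tinc T a).
Proof. by case: (exT a). Qed.
Let prj_hom a : mod_hom (tprj T a).
Proof. by case: (exT a). Qed.

Lemma tprj_tinc a : tprj T a *m tinc T a = 0.
Proof. by have [_ _ _ _ []] := (short_exact_ranks _ _).1 (exT a). Qed.

(** A chain map preserves the kernels of the projections onto syzygies, so it
    induces maps of syzygies. *)
Lemma chain_map_tinc s h a b : chain_map s h -> a = b + s ->
  tprj T b *m h a b *m tinc T a = 0.
Proof.
move=> ch ab; have [_ e] := ch a b ab.
have /lin_surjP : lin_surj (tprj T (a + 1)) by case: (exT (a + 1)).
move=> /rank_mulmx_full rk; apply/eqP; rewrite -mxrank_eq0 -rk.
by rewrite -!mulmxA -/(tdiff T a) -e /tdiff !mulmxA tprj_tinc !mul0mx mxrank0.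
Qed.

Lemma chain_map_acts s h : chain_map s h -> acts_on_classes s h.
Proof.
move=> ch a b ab; have [hh _] := ch a b ab.
have kill (u : 'cV_(mdim (term T a))) : tprj T a *m u = 0 -> tprj T b *m (h a b *m u) = 0.
  have [_ _ _ _ ker] := exT a; move=> /ker[y ->].
  by rewrite !mulmxA (chain_map_tinc ch ab) mul0mx.
split=> [u | u v [w ew]]; rewrite /is_class.
  rewrite !mulmxA -(tact_hom _ (@prj_hom a)) -(tact_hom _ (@prj_hom b)).
  by rewrite -!mulmxA (mulmxA _ (h a b)) -(tact_hom _ hh) -!mulmxA; apply: kill.
have [_ _ _ sur _] := exT a; have [w' ew'] := sur w.
exists (tprj T b *m h a b *m w').
have tw : tprj T b *m (h a b *m (tact (term T a) p.-1 *m w')) =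
    tact (syz T b) p.-1 *m (tprj T b *m h a b *m w').
  by rewrite (mulmxA (h a b)) (tact_hom _ hh) !mulmxA (tact_hom _ (@prj_hom b)).
apply/eqP; rewrite -subr_eq0 -tw -!mulmxBr; apply/eqP/kill.
rewrite mulmxBr (mulmxBr _ u) ew ew' !mulmxA.
by rewrite (tact_hom _ (@prj_hom a)) subrr.
Qed.

(** On syzygies, homotopic chain maps differ by a map that factors through the
    inclusion of syz (a' + 1) into the free module term a'. *)
Lemma homotopic_class_eq s h h' a b (u : 'cV_(mdim (term T a))) :
  homotopic s h h' -> a = b + s -> is_class u ->
  class_eq (h a b *m u) (h' a b *m u).
Proof.
case=> sg [hsg E] ab tu.
(* a homotopy is a condition on successors, and every integer is one *)
have [a' ea] : exists a', a = a' + 1 by exists (a - 1); rewrite subrK.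
have [b' eb] : exists b', b = b' + 1 by exists (b - 1); rewrite subrK.
move: u tu ab; rewrite {a}ea {b}eb => u tu ab.
have ab' : a' = b' + s by lia.
have hb : mod_hom (V := term T a') (W := syz T (b' + 1))
    (tprj T (b' + 1) *m sg a' (b' + 1)).
  move=> i; rewrite -mulmxA (hsg _ _ ab' i) !mulmxA; congr (_ *m _).
  exact: (@prj_hom (b' + 1) i).
have [w ew] := norm_cong_via_free p_gt1 (@inc_hom a') hb (frT a') tu.
exists w; rewrite subr0 in ew; rewrite -ew -!mulmxBr -mulmxBl (E _ _ ab').
rewrite mulmxDl mulmxDr /tdiff !mulmxA tprj_tinc !mul0mx add0r //.
Qed.

Lemma nonzero_class_exists a : stably_trivial 1 (syz T a) ->
  exists u : 'cV_(mdim (term T a)), nonzero_class u.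
Proof.
move=> /(socle_line p_gt1)[[w [tw nw]] _]; have [_ _ _ sur _] := exT a.
have [u eu] := sur w; exists u; rewrite /nonzero_class /is_class /class_eq.
by rewrite mulmx0 -eu.
Qed.

Lemma fone_mul a (u : 'cV_(mdim (term T a))) : fone T a a *m u = u.
Proof.
rewrite -[RHS]mul1mx; congr (_ *m _); apply/matrixP => i j.
by rewrite !mxE -val_eqE.
Qed.

Lemma acts_fone : acts_on_classes 0 (@fone _ _ T).
Proof.
move=> a b; rewrite addr0 => <-.
by split=> [u | u v]; rewrite !fone_mul.
Qed.

Lemma acts_fcomp s s' h h' : acts_on_classes s h -> acts_on_classes s' h' ->
  acts_on_classes (s + s') (fcomp s' h h').
Proof.
move=> gh gh' a b ab.
have [|Z B] := gh (a - s') b; first by rewrite ab addrA addrK.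
have [|Z' B'] := gh' a (a - s'); first by rewrite subrK.
split=> [u | u v]; rewrite /fcomp -!mulmxA; first by move=> /Z'/Z.
by move=> /B'/B.
Qed.

Section LaurentBasis.
Variables (e : int) (x y : graded_map T).
Hypotheses (chx : chain_map e x) (chy : chain_map (- e) y).
Hypothesis xy1 : homotopic 0 (fcomp (- e) x y) (@fone _ _ T).
Hypothesis yx1 : homotopic 0 (fcomp e y x) (@fone _ _ T).
Variable w0 : 'cV[K]_(mdim (term T 0)).
Hypothesis nz_w0 : nonzero_class w0.

Lemma xy_class a (u : 'cV_(mdim (term T a))) : is_class u ->
  class_eq (x (a + e) a *m (y a (a + e) *m u)) u.
Proof.
move=> tu; have := homotopic_class_eq xy1 (esym (addr0 a)) tu.
by rewrite fone_mul /fcomp opprK mulmxA.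
Qed.

Lemma yx_class a (u : 'cV_(mdim (term T a))) : is_class u ->
  class_eq (y (a - e) a *m (x a (a - e) *m u)) u.
Proof.
move=> tu; have := homotopic_class_eq yx1 (esym (addr0 a)) tu.
by rewrite fone_mul /fcomp mulmxA.
Qed.

(** The image of w0 in position a under n steps of degree d; it is meaningful
    for a = - n d, when the last rectangular identity is the identity of
    term 0. *)
Fixpoint iterate_class (h : graded_map T) (d : int) (n : nat) (a : int) :
    'cV[K]_(mdim (term T a)) :=
  if n is n'.+1 then h (a + d) a *m iterate_class h d n' (a + d)
  else fone T 0 a *m w0.

Definition basis_class (q a : int) : 'cV[K]_(mdim (term T a)) :=
  match q with
  | Posz n => iterate_class y (- e) n a
  | Negz n => iterate_class x e n.+1 a
  end.

Lemma x_nonzero b (u : 'cV_(mdim (term T (b + e)))) :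
  nonzero_class u -> nonzero_class (x (b + e) b *m u).
Proof.
case=> tu nu; have [Z _] := chain_map_acts chx (erefl (b + e)).
split; first exact: Z.
have [|_ B] := chain_map_acts chy (_ : b = b + e + - e); first by rewrite addrK.
move=> /B xu0; apply: nu; have := yx_class tu; rewrite addrK => yxu.
by apply: norm_cong_trans (norm_cong_sym yxu) _; rewrite mulmx0 in xu0.
Qed.

Lemma y_nonzero b (u : 'cV_(mdim (term T (b + - e)))) :
  nonzero_class u -> nonzero_class (y (b + - e) b *m u).
Proof.
case=> tu nu; have [Z _] := chain_map_acts chy (erefl (b + - e)).
split; first exact: Z.
have [|_ B] := chain_map_acts chx (_ : b = b + - e + e); first by rewrite subrK.
move=> /B xu0; apply: nu; have := xy_class tu; rewrite subrK => xyu.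
by apply: norm_cong_trans (norm_cong_sym xyu) _; rewrite mulmx0 in xu0.
Qed.

Lemma iterate_class_nonzero h d :
  (forall b (u : 'cV_(mdim (term T (b + d)))),
     nonzero_class u -> nonzero_class (h (b + d) b *m u)) ->
  forall n a, a + d *+ n = 0 -> nonzero_class (iterate_class h d n a).
Proof.
move=> hh; elim=> [|n IHn] a /=; first by rewrite addr0 => ->; rewrite fone_mul.
by rewrite mulrS addrA => /IHn/hh.
Qed.

Lemma basis_class_nonzero q a : a = q * e -> nonzero_class (basis_class q a).
Proof.
move=> ->; case: q => n; apply: iterate_class_nonzero.
- exact: y_nonzero.
- by rewrite mulNrn -mulr_natl natz subrr.
- exact: x_nonzero.
by rewrite NegzE -[e *+ _]mulr_natl natz mulNr addNr.
Qed.

Lemma x_basis_class q b : b + e = q * e ->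
  class_eq (x (b + e) b *m basis_class q (b + e)) (basis_class (q - 1) b).
Proof.
move=> bq; case: q bq => [[|n]|n] bq.
- by rewrite (_ : 0%:Z - 1 = Negz 0); first exact: norm_cong_refl.
- rewrite (_ : n.+1%:Z - 1 = n); last by lia.
  have [] : nonzero_class (basis_class n b).
    by apply: basis_class_nonzero; lia.
  by move=> tb _; have := xy_class tb; rewrite /= addrK.
by rewrite (_ : Negz n - 1 = Negz n.+1); [exact: norm_cong_refl | lia].
Qed.

Hypothesis e_gt0 : 0 < e.

(** For a divisible by e, the basis vector W_a is the image of w0 under
    x^(- a / e). *)
Definition coherent_class (a : int) := basis_class (a %/ e)%Z a.

Lemma coherent_class_nonzero a : (e %| a)%Z -> nonzero_class (coherent_class a).
Proof. by move=> /divzK ea; apply: basis_class_nonzero. Qed.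

Lemma x_coherent a b : (e %| a)%Z -> a = b + e ->
  class_eq (x a b *m coherent_class a) (coherent_class b).
Proof.
move=> + ab; rewrite {a}ab => ea; rewrite /coherent_class.
have -> : (b %/ e)%Z = (((b + e)%R : int) %/ e)%Z - 1.
  case/dvdzP: ea => q eq; have eb : b = (q - 1) * e.
    by rewrite mulrBl mul1r -eq addrK.
  by rewrite eq eb !mulzK ?gt_eqF.
by apply: x_basis_class; rewrite divzK.
Qed.

Lemma y_coherent a b : (e %| a)%Z -> a = b + - e ->
  class_eq (y a b *m coherent_class a) (coherent_class b).
Proof.
move=> + ab; rewrite {a}ab => eb.
have ebb : (e %| b)%Z by rewrite -(subrK e b) rpredD ?dvdzz.
have [tb _] := coherent_class_nonzero ebb.
have [|_ B] := chain_map_acts chy (_ : b - e = b + - e); first by [].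
have /B h := x_coherent ebb (esym (subrK e b)).
apply: norm_cong_trans (norm_cong_sym h) _.
exact: yx_class.
Qed.

Lemma fpow_coherent d h : acts_on_classes d h -> (e %| d)%Z ->
  (forall a b, (e %| a)%Z -> a = b + d ->
     class_eq (h a b *m coherent_class a) (coherent_class b)) ->
  forall n a b, (e %| a)%Z -> a = b + d *+ n ->
     class_eq (fpow d h n a b *m coherent_class a) (coherent_class b).
Proof.
move=> gh ed hh.
have gp n : acts_on_classes (d *+ n) (fpow d h n).
  elim: n => [|n IHn]; first exact: acts_fone.
  by rewrite mulrSr; apply: acts_fcomp.
elim=> [|n IHn] a b ea ab.
  by rewrite mulr0n addr0 in ab; rewrite -ab fone_mul; apply: norm_cong_refl.
have ab' : a - d = b + d *+ n by rewrite ab mulrSr addrA addrK.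
have [_ B] := gp n _ _ ab'.
rewrite [fpow _ _ _]/(fcomp d (fpow d h n) h) /fcomp -mulmxA.
apply: (norm_cong_trans (B _ _ (hh a (a - d) ea (esym (subrK d a))))).
by apply: IHn => //; rewrite rpredB.
Qed.

(** Every power of the generator maps basis vectors to basis vectors, so that a
    scalar multiple of it has that scalar as its matrix. *)
Lemma fzpow_coherent r a b : (e %| a)%Z -> a = b + r * e ->
  class_eq (fzpow e x y r a b *m coherent_class a) (coherent_class b).
Proof.
case: r => n ea ab.
  apply: fpow_coherent => //; first exact: chain_map_acts.
  - exact: x_coherent.
  by rewrite ab -mulr_natl natz.
apply: fpow_coherent => //; first exact: chain_map_acts.
- by rewrite rpredN.
- exact: y_coherent.
by rewrite ab mulNrn -mulr_natl natz NegzE mulNr.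
Qed.
End LaurentBasis.
End TowerClasses.

(** * The exact sequence at a pi-point *)

Lemma tact_dsum_mxcol (K : fieldType) (p n : nat)
    (V : 'I_n -> fdmod (trunc_alg K p)) i (y : forall j, 'cV_(mdim (V j))) :
  tact (dsum V) i *m \mxcol_j y j = \mxcol_j (tact (V j) i *m y j).
Proof.
have [le_pi|lt_ip] := leqP p i.
  rewrite tact_ge // mul0mx -mxcol0; apply: eq_mxcol => j.
  by rewrite tact_ge // mul0mx.
rewrite (tactE (dsum V) (Ordinal lt_ip)) /= /dsum_act mul_mxdiag_mxcol.
by apply: eq_mxcol => j; rewrite (tactE (V j) (Ordinal lt_ip)).
Qed.

Lemma tact_dsum2_col_mx (K : fieldType) (p : nat)
    (V W : fdmod (trunc_alg K p)) i (y : 'cV_(mdim V)) (z : 'cV_(mdim W)) :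
  tact (dsum2 V W) i *m col_mx y z = col_mx (tact V i *m y) (tact W i *m z).
Proof.
have [le_pi|lt_ip] := leqP p i.
  by rewrite !tact_ge // !mul0mx col_mx0.
rewrite (tactE (dsum2 V W) (Ordinal lt_ip)) /= mul_block_col !mul0mx addr0 add0r.
by rewrite (tactE V (Ordinal lt_ip)) (tactE W (Ordinal lt_ip)).
Qed.

Section AtPiPoint.
Variables (k : fieldType) (p : nat) (G : fin_group_scheme k).
Hypothesis p_gt1 : (1 < p)%N.
Variables (T : tower (group_alg G)) (pi : pi_point G p).
Local Notation iota := (pext pi).
Local Notation TK := (pi_tower pi T).

Lemma tact_pi_restrict_dsum n (V : 'I_n -> fdmod (group_alg G)) i :
  tact (pi_restrict pi (dsum V)) i = tact (dsum (fun j => pi_restrict pi (V j))) i.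
Proof.
have := tact_hom i (proj1 (pi_restrict_dsum pi V)).
by rewrite mul1mx mulmx1 => ->.
Qed.

Lemma tact_pi_restrict_dsum2 (V W : fdmod (group_alg G)) i :
  tact (pi_restrict pi (dsum2 V W)) i =
  tact (dsum2 (pi_restrict pi V) (pi_restrict pi W)) i.
Proof.
have := tact_hom i (proj1 (pi_restrict_dsum2 pi V W)).
by rewrite mul1mx mulmx1 => ->.
Qed.

Hypothesis hT : complete_resolution (trivial_mod G) T.

Lemma pi_tower_exact a : short_exact (tinc TK a) (tprj TK a).
Proof. by case: hT => ex _ _; apply: pi_restrict_short_exact. Qed.

Lemma pi_tower_free a : stably_trivial 0 (term TK a).
Proof. by case: hT => _ pr _; apply: pi_restrict_projective. Qed.

Lemma mod_iso_sym (K : fieldType) (A : fdalg K) (V W : fdmod A) (f : lin V W) :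
  mod_iso f -> exists g : lin W V, [/\ mod_iso g, f *m g = 1%:M & g *m f = 1%:M].
Proof.
case=> hf [g [fg gf]]; exists g; split=> //; split; last by exists f.
move=> i; rewrite -[LHS]mulmx1 -fg -mulmxA [mact W i *m _]mulmxA -hf.
by rewrite !mulmxA gf mul1mx.
Qed.

Lemma pi_syz_trivial a : (gen_degree p %| a)%Z -> stably_trivial 1 (syz TK a).
Proof.
move=> ea; have h0 : stably_trivial 1 (syz TK 0).
  case: hT => _ _ [f /mod_iso_sym[g [isog _ _]]].
  exact: stably_trivial_iso (pi_restrict_iso pi isog) (pi_restrict_trivial pi p_gt1).
have := heller_parity_tower p_gt1 pi_tower_exact pi_tower_free h0 a.
move: ea; rewrite /gen_degree; case: eqP => [p2 _|_ -> //].
exact: heller_parity2 p2.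
Qed.

(** Stably equal maps agree on ker t / im t^(p-1), as projectives become
    free. *)
Lemma represents_norm_cong (a b : int) (z : graded_map T)
    (zh : lin (syz T a) (syz T b)) (u : 'cV_(mdim (term TK a))) :
  represents z zh -> is_class u ->
  norm_cong (V := syz TK b)
    (map_mx iota zh *m (tprj TK a *m u)) (tprj TK b *m (pi_family pi z a b *m u)).
Proof.
case=> g [hg gz [Q [al [be [prQ hal hbe e]]]]] tu.
have -> : tprj TK b *m (pi_family pi z a b *m u) = map_mx iota g *m (tprj TK a *m u).
  by rewrite !mulmxA /= /pi_family -!map_mxM gz.
have frQ := pi_restrict_projective pi p_gt1 prQ.
have hal' := pi_restrict_hom (pi := pi) hal.
have hbe' := pi_restrict_hom (pi := pi) hbe.
have [w ew] := norm_cong_via_free p_gt1 hal' hbe' frQ tu.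
exists w; rewrite subr0 in ew; rewrite -ew -mulmxBl; congr (_ *m _).
by rewrite -map_mxM -e raddfB.
Qed.

Section Ranks.
Variables (m n : nat) (dm : 'I_m -> int) (dn : 'I_n -> int).
Hypothesis even_m : forall j, (gen_degree p %| dm j)%Z.
Hypothesis even_n : forall i, (gen_degree p %| dn i)%Z.
Variables (zeta : 'I_n -> 'I_m -> graded_map T).
Variable zhat : forall (i : 'I_n) (j : 'I_m),
  'M[k]_(mdim (syz T (dn i)), mdim (syz T (dm j))).
Hypothesis zhatP : forall i j, represents (zeta i j) (zhat i j).
Hypothesis rank_n : tate_rank (gen_degree p) (fun i j => dm j - dn i)
       (fun i j => pi_family pi (zeta i j)) n.

(** On the lines ker t / im t^(p-1) with their coherent bases, the map zhat i j
    is the scalar c i j; the lift y comes from a right inverse D of c. *)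
Lemma zhat_matrix_onto_socle (z : forall i, 'cV[pfield pi]_(mdim (syz TK (dn i)))) :
  (forall i, tact (syz TK (dn i)) 1 *m z i = 0) ->
  exists y : forall j, 'cV[pfield pi]_(mdim (syz TK (dm j))),
    (forall j, tact (syz TK (dm j)) 1 *m y j = 0) /\
    forall i, norm_cong (V := syz TK (dn i)) (z i)
                (\sum_j map_mx iota (zhat i j) *m y j).
Proof.
move=> tz; have [x [y [c [lau hz rc]]]] := rank_n.
case: lau => [[chx chy] xy1 yx1 _].
have e_gt0 : 0 < gen_degree p by rewrite /gen_degree; case: ifP.
have [w0 nz0] := nonzero_class_exists p_gt1 pi_tower_exact (pi_syz_trivial (dvdz0 _)).
pose W a := tprj TK a *m coherent_class (gen_degree p) x y w0 a.
have nzW a : (gen_degree p %| a)%Z ->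
    nonzero_class (coherent_class (gen_degree p) x y w0 a).
  exact: (coherent_class_nonzero p_gt1 pi_tower_exact pi_tower_free chx chy xy1 yx1 nz0).
have zW i j : norm_cong (V := syz TK (dn i)) (map_mx iota (zhat i j) *m W (dm j))
                       (c i j *: W (dn i)).
  have [tW _] := nzW _ (even_m j).
  apply: norm_cong_trans (represents_norm_cong (zhatP i j) tW) _.
  have ab : dm j = dn i + (dm j - dn i) by rewrite addrC subrK.
  have hzW := homotopic_class_eq p_gt1 pi_tower_exact pi_tower_free (hz i j) ab tW.
  apply: norm_cong_trans hzW _.
  rewrite /fscale -scalemxAl -scalemxAr; apply: norm_cong_scale.
  apply: (fzpow_coherent p_gt1 pi_tower_exact pi_tower_free chx chy xy1 yx1 nz0) => //.
  by rewrite divzK ?rpredB.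
have /fin_all_exists[d dz] i : exists d,
    norm_cong (V := syz TK (dn i)) (z i) (d *: W (dn i)).
  have [_ line] := socle_line p_gt1 (pi_syz_trivial (even_n i)).
  have [tW nW] := nzW _ (even_n i); rewrite /class_eq mulmx0 in nW.
  exact: line.
pose D := pinvmx c.
have cD : c *m D = 1%:M by rewrite mulmxVp // /row_free rc.
exists (fun j => (\sum_i D j i * d i) *: W (dm j)); split.
  by move=> j; have [tW _] := nzW _ (even_m j); rewrite -scalemxAr tW scaler0.
move=> i; apply: norm_cong_trans (dz i) _; apply: norm_cong_sym.
have -> : d i = \sum_j (\sum_i' D j i' * d i') * c i j.
  transitivity ((c *m D *m (\col_i d i)) i 0); first by rewrite cD mul1mx mxE.
  rewrite -mulmxA mxE; apply: eq_bigr => j _; rewrite mxE mulrC.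
  by congr (_ * _); apply: eq_bigr => i' _; rewrite mxE.
rewrite scaler_suml; apply: norm_cong_sum => j.
rewrite -scalemxAr -scalerA; apply: norm_cong_scale; exact: zW.
Qed.

End Ranks.
End AtPiPoint.

Theorem theorem7p6 (k : fieldType) (p : nat) (charkp : p \in [pchar k])
  (G : fin_group_scheme k)
  (T : tower (group_alg G)) (hT : heller_resolution (trivial_mod G) T)
  (m n : nat) (n_gt0 : (0 < n)%N) (lt_nm : (n < m)%N)
  (dm : 'I_m -> int) (dn : 'I_n -> int)
  (even_d : (2 < p)%N ->
     (forall j, (2 %| dm j)%Z) /\ (forall i, (2 %| dn i)%Z))
  (zeta : 'I_n -> 'I_m -> graded_map T)
  (zetaP : forall i j, chain_map (dm j - dn i) (zeta i j))
  (zhat : forall (i : 'I_n) (j : 'I_m), lin (syz T (dm j)) (syz T (dn i)))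
  (zhat_hom : forall i j, mod_hom (zhat i j))
  (zhatP : forall i j, represents (zeta i j) (zhat i j))
  (L M N Q : fdmod (group_alg G)) (f : lin L M) (phi : lin M N)
  (exact_LMN : short_exact f phi)
  (projQ : projective Q)
  (u : lin (dsum2 (dsum (fun j => syz T (dm j))) Q) M) (isoM : mod_iso u)
  (v : lin (dsum (fun i => syz T (dn i))) N) (isoN : mod_iso v)
  (phiE : exists psi : lin Q (dsum (fun i => syz T (dn i))),
     phi *m u = v *m row_mx (\mxblock_(i, j) zhat i j) psi)
  (rank_n : forall pi : pi_point G p,
     tate_rank (gen_degree p) (fun i j => dm j - dn i)
       (fun i j => pi_family pi (zeta i j)) n) :
  stable_constant_jordan_type p L
    (fun i => if i == 0%N then (m - n)%N else 0%N).
Proof.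
have p_gt1 : (1 < p)%N by apply: prime_gt1; case/andP: charkp.
have [resT _ _] := hT.
have [even_m even_n] : (forall j, (gen_degree p %| dm j)%Z) /\
    (forall i, (gen_degree p %| dn i)%Z).
  rewrite /gen_degree; case: eqP => [_|p2]; first by split=> i; apply: dvd1z.
  by apply: even_d; lia.
(* the number of blocks [p] is forced by dim L, whatever the pi-point *)
exists (fun i : 'I_p => if i == 0 :> nat then (m - n)%N else
          if i == p.-1 :> nat then ((mdim L - (m - n)) %/ p)%N else 0%N).
split; last by move=> i lt_ip; rewrite (_ : i == p.-1 :> nat = false) //; lia.
move=> pi; suff trL : stably_trivial (m - n) (pi_restrict pi L).
  apply: (@jordan_type_of_stably_trivial _ _ p_gt1 _ _ _ _ trL) => //.
  by case: trL => _ /= {1}->; rewrite addKn mulKn // ltnW.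
have trivs d (D : 'I_d -> int) : (forall i, (gen_degree p %| D i)%Z) ->
    stably_trivial d (pi_restrict pi (dsum (fun i => syz T (D i)))).
  move=> hD; apply: stably_trivial_iso (pi_restrict_dsum pi _) _.
  have := @stably_trivial_dsum _ _ _ (fun i => pi_restrict pi (syz T (D i))) (fun=> 1%N).
  rewrite sum1_card card_ord; apply => i; exact: (pi_syz_trivial p_gt1 pi resT (hD i)).
have trN : stably_trivial n (pi_restrict pi N).
  exact: stably_trivial_iso (pi_restrict_iso pi isoN) (trivs _ _ even_n).
have trM : stably_trivial m (pi_restrict pi M).
  apply: stably_trivial_iso (pi_restrict_iso pi isoM) _.
  apply: stably_trivial_iso (pi_restrict_dsum2 pi _ _) _.
  have := stably_trivial_dsum2 (trivs _ _ even_m) (pi_restrict_projective pi p_gt1 projQ).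
  by rewrite addn0.
have exK := pi_restrict_short_exact pi exact_LMN.
apply: (kernel_stably_trivial p_gt1 exK (ltnW lt_nm) trM trN).
move=> z tz.
have [v' [isov' vv' v'v]] := mod_iso_sym (pi_restrict_iso pi isoN).
pose z' i : 'cV[pfield pi]_(mdim (syz T (dn i))) := submxcol (v' *m z) i.
have ez : z = map_mx (pext pi) v *m \mxcol_i z' i.
  by rewrite submxcolK mulmxA vv' mul1mx.
have tz' i : tact (pi_restrict pi (syz T (dn i))) 1 *m z' i = 0.
  have : tact (pi_restrict pi (dsum (fun i => syz T (dn i)))) 1 *m (v' *m z) = 0.
    by rewrite mulmxA -(tact_hom _ (proj1 isov')) -mulmxA tz mulmx0.
  rewrite tact_pi_restrict_dsum -[v' *m z]submxcolK.
  rewrite (tact_dsum_mxcol (V := fun i => pi_restrict pi (syz T (dn i)))) -mxcol0.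
  by move/eq_mxcolP/(_ i).
have [y [ty yz]] := zhat_matrix_onto_socle p_gt1 resT even_m even_n zhatP (rank_n pi) tz'.
have /fin_all_exists[w ew] := yz.
have [psi psiE] := phiE.
pose y' : 'cV[pfield pi]_(_ + _) := col_mx (\mxcol_j y j) (0 : 'cV_(mdim Q)).
exists (map_mx (pext pi) u *m y'), (map_mx (pext pi) v *m \mxcol_i w i); split.
  rewrite mulmxA -(tact_hom _ (pi_restrict_hom (pi := pi) (proj1 isoM))) -mulmxA.
  rewrite tact_pi_restrict_dsum2.
  rewrite (tact_dsum2_col_mx (V := pi_restrict pi (dsum (fun j => syz T (dm j))))
    (W := pi_restrict pi Q)).
  rewrite tact_pi_restrict_dsum.
  rewrite (tact_dsum_mxcol (V := fun j => pi_restrict pi (syz T (dm j)))).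
  rewrite mulmx0 (eq_mxcol (fun j => ty j)) mxcol0 col_mx0.
  by rewrite mulmx0.
rewrite mulmxA -map_mxM psiE map_mxM -[map_mx _ _ *m _ *m y']mulmxA.
rewrite [tact _ p.-1 *m _]mulmxA -(tact_hom _ (pi_restrict_hom (pi := pi) (proj1 isoN))).
rewrite -[X in _ + X]mulmxA -mulmxDr {1}ez; congr (_ *m _).
rewrite tact_pi_restrict_dsum.
rewrite (tact_dsum_mxcol (V := fun i => pi_restrict pi (syz T (dn i)))).
rewrite map_row_mx mul_row_col mulmx0 addr0.
have -> : map_mx (pext pi) (\mxblock_(i, j) zhat i j) =
    \mxblock_(i, j) map_mx (pext pi) (zhat i j) by apply/matrixP => a b; rewrite !mxE.
rewrite mxblockEv mxcol_mul -mxcolD; apply: eq_mxcol => i.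
by rewrite mul_mxrow_mxcol -(ew i) addrC subrK.
Qed.
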